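(* Let $G$ be an irreducible triangulation of a surface $S$ other than the sphere, let $v$ be a vertex of $G$, and let $L$ be the link of $v$. Then there are two nonseparating $3$-cycles $v v_i v_k$ and $v v_j v_l$ of $G$, with $v_i,v_j,v_k,v_l$ distinct vertices of $L$, such that one of the two paths from $v_i$ to $v_k$ in $L$ contains $v_j$ and the other path from $v_i$ to $v_k$ in $L$ contains $v_l$.
   Context: A surface is a compact two-dimensional manifold (without boundary). All graphs are simple. A map on $S$ is a connected simple graph embedded in $S$ such that every face (connected component of the complement of the graph) is homeomorphic to an open disk. If $v_1v_2,v_2v_3,v_3v_1$ are edges, their union is the $3$-cycle $v_1v_2v_3$. A triangulation of $S$ is a map in which the boundary of every face is a $3$-cycle (excluding a single $3$-cycle on the sphere). An edge is contractible if it lies on exactly two $3$-cycles and both are face boundaries; an irreducible triangulation is a triangulation with no contractible edge. The link of a vertex $v$ in a triangulation is the cycle forming the boundary of the union of the faces containing $v$. A $3$-cycle is nonseparating if its complement in $S$ is connected. *)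

(* Defs.v *)
From HB Require Import structures.
From mathcomp Require Import all_boot all_order all_algebra.
From mathcomp Require Import all_classical all_reals all_analysis.

Set Implicit Arguments.
Unset Strict Implicit.
Unset Printing Implicit Defensive.

Import Order.TTheory GRing.Theory Num.Theory.
Import numFieldNormedType.Exports.

Local Open Scope classical_set_scope.
Local Open Scope ring_scope.

(* The subsets A and B, with their subspace topologies, are homeomorphic. *)
Definition homeomorphic (T U : topologicalType) (A : set T) (B : set U) : Prop :=
  exists (f : T -> U) (g : U -> T),
    [/\ {within A, continuous f}, {within B, continuous g},
        (forall x, A x -> B (f x) /\ g (f x) = x)
      & (forall y, B y -> A (g y) /\ f (g y) = y)].

Definition frontier (T : topologicalType) (A : set T) : set T :=
  closure A `\` interior A.

Definition open_disk (R : realType) : set (R * R) :=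
  [set z | z.1 ^+ 2 + z.2 ^+ 2 < 1].

Definition closed_disk (R : realType) : set (R * R) :=
  [set z | z.1 ^+ 2 + z.2 ^+ 2 <= 1].

Definition unit_circle (R : realType) : set (R * R) :=
  [set z | z.1 ^+ 2 + z.2 ^+ 2 = 1].

Definition unit_sphere (R : realType) : set (R * R * R) :=
  [set z | z.1.1 ^+ 2 + z.1.2 ^+ 2 + z.2 ^+ 2 = 1].

(* Second countability is automatic for compact locally Euclidean spaces, and
   a surface carrying a map is automatically connected. *)
Definition is_surface (R : realType) (S : topologicalType) : Prop :=
  [/\ compact [set: S], hausdorff_space S
    & forall x : S, exists U : set S,
        [/\ open U, U x & homeomorphic U (@open_disk R)]].

Definition is_sphere (R : realType) (S : topologicalType) : Prop :=
  homeomorphic [set: S] (@unit_sphere R).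

Definition is_arc (R : realType) (S : topologicalType) (A : set S) (a b : S)
    : Prop :=
  exists g : R -> S,
    [/\ {within `[0, 1], continuous g}, set_inj `[0, 1] g,
        g @` `[0, 1] = A, g 0 = a & g 1 = b].

(* A finite simple graph (V, adj) embedded in S.  [curve x y] is the point set
   of the edge xy; its value is irrelevant when x and y are not adjacent. *)
Record embedded_graph (R : realType) (S : topologicalType) (V : finType) :=
  EmbeddedGraph {
    adj : rel V;
    adj_sym : symmetric adj;
    adj_irr : irreflexive adj;
    vpt : V -> S;
    vpt_inj : injective vpt;
    curve : V -> V -> set S;
    curveC : forall x y, curve x y = curve y x;
    curve_arc : forall x y, adj x y -> is_arc R (curve x y) (vpt x) (vpt y);
    curve_vpt : forall x y z,
      adj x y -> curve x y (vpt z) -> z = x \/ z = y;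
    curve_meet : forall x y z w p,
      adj x y -> adj z w -> curve x y p -> curve z w p ->
      range vpt p \/ (x = z /\ y = w) \/ (x = w /\ y = z)
  }.

Section Maps.
Variables (R : realType) (S : topologicalType) (V : finType).
Variable G : embedded_graph R S V.
Implicit Types (x y z v : V) (F : set S) (L : seq V).

Definition graph_set : set S :=
  range (vpt G) `|` [set p | exists x y, adj G x y /\ curve G x y p].

Definition is_face F : Prop :=
  exists2 p, (~` graph_set) p & F = connected_component (~` graph_set) p.

Definition is_map : Prop :=
  [/\ is_surface R S,
      (forall x y, connect (adj G) x y)
    & (forall F, is_face F -> homeomorphic F (@open_disk R))].

Definition cycle3 x y z : Prop := [/\ adj G x y, adj G y z & adj G z x].

Definition cycle3_set x y z : set S :=
  curve G x y `|` curve G y z `|` curve G z x.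

(* The boundary of the face F, traversed once around F, is the 3-cycle xyz:
   the closed face is a closed disk whose boundary circle is xyz.  (The weaker
   condition closure F `\` F = cycle3_set x y z would also hold for the
   noncontractible 3-cycle K_3 in the projective plane, whose only face has the
   boundary walk xyzxyz of length 6.)  As closed_disk is compact and S is
   Hausdorff, f is a homeomorphism onto closure F. *)
Definition bounds_face F x y z : Prop :=
  cycle3 x y z /\
  exists f : R * R -> S,
    [/\ {within @closed_disk R, continuous f}, set_inj (@closed_disk R) f,
        f @` @open_disk R = F & f @` @unit_circle R = cycle3_set x y z].

Definition facial x y z : Prop := exists2 F, is_face F & bounds_face F x y z.

Definition is_triangulation : Prop :=
  [/\ is_map,
      (forall F, is_face F -> exists x y z, bounds_face F x y z)
    & ~ (is_sphere R S /\
         exists x y z, cycle3 x y z /\ graph_set = cycle3_set x y z)].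

(* The graph being simple, the 3-cycles through the edge xy correspond to
   their third vertices. *)
Definition contractible x y : Prop :=
  adj G x y /\
  exists z w,
    [/\ z <> w, facial x y z, facial x y w
      & forall u, cycle3 x y u -> u = z \/ u = w].

Definition is_irreducible_triangulation : Prop :=
  is_triangulation /\ forall x y, ~ contractible x y.

Definition star v : set S :=
  [set p | exists F, [/\ is_face F, closure F (vpt G v) & closure F p]].

Definition is_cycle L : Prop :=
  [/\ (2 < size L)%N, uniq L & cycle (adj G) L].

Definition cycle_set L : set S :=
  [set p | exists2 x, x \in L & curve G x (next L x) p].

Definition is_link v L : Prop :=
  is_cycle L /\ cycle_set L = frontier (star v).

Definition nonseparating_cycle3 x y z : Prop :=
  cycle3 x y z /\ connected (~` cycle3_set x y z).

End Maps.

(* The two paths between distinct vertices x and y of the cycle L are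
   [link_path L x y] and the reversal of [link_path L y x]. *)
Definition link_path (V : eqType) (L : seq V) (x y : V) : seq V :=
  rcons (arc L x y) y.

(* Main.v *)
(* Non-contractibility of the edges at v makes every vertex of the link L an end
   of a chord of L, that is, of an edge joining two non-consecutive vertices of
   L.  A chord spanning the shortest stretch of L is crossed by any chord from an
   interior vertex of that stretch.  If the chords xy and ab cross, then vxy is
   nonseparating: both open arcs of L lie in one component M of the complement,
   being joined by ab; so all faces at v lie in M; turning around x without
   crossing xy, all faces at x lie in M, likewise at y, and then everywhere,
   since the graph is connected.

   Turning around a vertex needs every edge to lie on exactly two faces and the
   faces at a vertex to be cyclically connected through its edges.  The former
   follows from invariance of domain in the plane: two faces glued along an edge
   form a neighbourhood of its inner points, and neither an arc nor a closed disk
   is a neighbourhood of its (boundary) points in a surface.  Invariance of domain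
   is obtained from the Poincare-Miranda theorem, itself a consequence of a
   parity argument on a coloured grid. *)

Require Import Defs.
From mathcomp Require Import all_boot all_order all_algebra.
From mathcomp Require Import all_classical all_reals all_analysis.
From mathcomp Require Import lra zify.

Set Implicit Arguments.
Unset Strict Implicit.
Unset Printing Implicit Defensive.

Import Order.TTheory GRing.Theory Num.Theory.
Import numFieldNormedType.Exports.

Local Open Scope classical_set_scope.
Local Open Scope ring_scope.

(** * Invariance of domain in the plane *)

(** No cyclic order of the faces around a vertex is ever built. Turning around a vertex is a closure
    property of sets of faces: a nonempty set of faces at x that is closed under crossing the edges
    at x contains all faces at x, because a small punctured neighbourhood of x is connected. For
    nonseparation the edge xy must not be crossed, while crossing xv is harmless once all faces at v
    are known to lie in M. That one edge can be spared is obvious for a cyclic arrangement; without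
    the arrangement it follows from a parity count.

    The link is given only topologically, as the frontier of the star. Inner points of its edges
    show that each edge of the link spans a face with v, and turning around v shows that there are
    no other faces at v. *)

Section SpernerGrid.
Variables (n : nat) (a b : nat -> nat -> bool).

Let bc i j k l := [&& ~~ a i j, ~~ a k l & b i j (+) b k l].
Let col i m := \big[addb/false]_(j < m) bc i j i j.+1.

(** The grid points carry three colours: [a]; not [a] but [b]; neither. If no unit square shows all
    three, every triangle has an even number of edges joining the last two colours ([bc]), so the
    parity [col i n] of such edges in column i does not depend on i. It is even on the left, where
    all points have [a], and odd on the right, where [b] changes between bottom and top. *)
Lemma sperner_grid :
  (forall j, (j <= n)%N -> a 0 j) ->
  (forall j, (j <= n)%N -> ~~ a n j) ->
  (forall i, (i <= n)%N -> ~~ a i 0 -> b i 0) ->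
  (forall i, (i <= n)%N -> ~~ a i n -> ~~ b i n) ->
  exists i j, [/\ (i < n)%N, (j < n)%N & exists p q r : bool * bool,
    [/\ a (i + p.1) (j + p.2),
        ~~ a (i + q.1) (j + q.2) && b (i + q.1) (j + q.2)
      & ~~ a (i + r.1) (j + r.2) && ~~ b (i + r.1) (j + r.2)]].
Proof.
move=> aL aR bB bT; apply: contrapT => no3.
(* The premise excludes the six ways to put the three colours on the corners; the rest is a truth
   table. *)
have tri x1 y1 x2 y2 x3 y3 : ~~ [|| [&& x1, ~~ x2, y2, ~~ x3 & ~~ y3],
    [&& x1, ~~ x3, y3, ~~ x2 & ~~ y2], [&& x2, ~~ x1, y1, ~~ x3 & ~~ y3],
    [&& x2, ~~ x3, y3, ~~ x1 & ~~ y1], [&& x3, ~~ x1, y1, ~~ x2 & ~~ y2]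
    | [&& x3, ~~ x2, y2, ~~ x1 & ~~ y1]] ->
   [&& ~~ x1, ~~ x2 & y1 (+) y2] (+) [&& ~~ x2, ~~ x3 & y2 (+) y3]
     = [&& ~~ x1, ~~ x3 & y1 (+) y3].
  by case: x1 x2 x3 y1 y2 y3 => [] [] [] [] [] [].
have no i j (p q r : bool * bool) : (i < n)%N -> (j < n)%N ->
    [&& a (i + p.1) (j + p.2), ~~ a (i + q.1) (j + q.2), b (i + q.1) (j + q.2),
     ~~ a (i + r.1) (j + r.2) & ~~ b (i + r.1) (j + r.2)] -> False.
  move=> ilt jlt /and5P[h1 h2 h3 h4 h5]; apply: no3; exists i, j; split => //.
  by exists p, q, r; split => //; apply/andP.
have triE i j (p q r : bool * bool) : (i < n)%N -> (j < n)%N ->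
    bc (i + p.1) (j + p.2) (i + q.1) (j + q.2)
      (+) bc (i + q.1) (j + q.2) (i + r.1) (j + r.2)
    = bc (i + p.1) (j + p.2) (i + r.1) (j + r.2).
  move=> ilt jlt; apply: tri; apply/negP.
  by case/orP=> [|/orP[|/orP[|/orP[|/orP[|]]]]]; apply: no.
(* The two triangles of a unit square share the diagonal from (i, j) to (i+1, j+1). *)
have sq i j : (i < n)%N -> (j < n)%N ->
    bc i j i.+1 j (+) bc i.+1 j i.+1 j.+1 = bc i j i j.+1 (+) bc i j.+1 i.+1 j.+1.
  move=> ilt jlt.
  have := triE i j (false, false) (true, false) (true, true) ilt jlt.
  have := triE i j (false, false) (false, true) (true, true) ilt jlt.
  by rewrite /= !addn0 !addn1 => -> ->.
(* Adding up the squares of a strip leaves only its bottom and top edges, which [colE] discards by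
   the boundary colours. *)
have colS i m : (i < n)%N -> (m <= n)%N ->
    col i.+1 m (+) col i m = bc i 0 i.+1 0 (+) bc i m i.+1 m.
  move=> ilt; elim: m => [_|m IH mlt].
    by rewrite /col !big_ord0 !addbb.
  rewrite /col !big_ord_recr /= -/(col _ _) -/(col _ _).
  have := IH (ltnW mlt); have := sq i m ilt mlt.
  by move: (bc i m i.+1 m) (bc i.+1 m i.+1 m.+1) (bc i m i m.+1)
    (bc i m.+1 i.+1 m.+1) (col i.+1 m) (col i m) (bc i 0 i.+1 0)
    => [] [] [] [] [] [] [].
have colE i : (i <= n)%N -> col i n = false.
  elim: i => [_|i IH ilt].
    by rewrite /col big1 // => j _; rewrite /bc aL //; apply: ltnW.
  have := colS i n ilt (leqnn n); rewrite (IH (ltnW ilt)) addbF => ->.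
  have -> : bc i 0 i.+1 0 = false.
    by apply/negP => /and3P[u w]; rewrite !bB // ltnW.
  apply/negP => /and3P[u w].
  by rewrite (negbTE (bT _ _ u)) ?(negbTE (bT _ _ w)) // ltnW.
have colR m : (m <= n)%N -> col n m = b n 0 (+) b n m.
  elim: m => [_|m IH mlt]; first by rewrite /col big_ord0 addbb.
  rewrite /col big_ord_recr /= -/(col _ _) (IH (ltnW mlt)) /bc.
  by rewrite !aR ?(ltnW mlt) //=; do 3! case: (b _ _).
have := colR n (leqnn n); rewrite (colE n (leqnn n)) bB ?aR //.
by rewrite (negbTE (bT n _ _)) ?aR.
Qed.

End SpernerGrid.

(** * Continuity on subsets and inverses on compact sets *)

Lemma continuous_pair (T U V : topologicalType) (f : T -> U) (g : T -> V) :
  continuous f -> continuous g -> continuous (fun x => (f x, g x)).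
Proof. by move=> cf cg x; apply: cvg_pair; [exact: cf | exact: cg]. Qed.

Lemma continuous_fst (T U V : topologicalType) (f : T -> U * V) :
  continuous f -> continuous (fun x => (f x).1).
Proof. by move=> cf x; apply: continuous_comp; [exact: cf | exact: cvg_fst]. Qed.

Lemma continuous_snd (T U V : topologicalType) (f : T -> U * V) :
  continuous f -> continuous (fun x => (f x).2).
Proof. by move=> cf x; apply: continuous_comp; [exact: cf | exact: cvg_snd]. Qed.

Lemma within_continuous_comp_sub (T U V : topologicalType) (A : set T)
    (K : set U) (r : T -> U) (f : U -> V) :
  {within A, continuous r} -> (forall x, A x -> K (r x)) ->
  {within K, continuous f} -> {within A, continuous (f \o r)}.
Proof.
move=> /subspace_continuousP cr rK /subspace_continuousP cf.
apply/subspace_continuousP => x Ax W /= Wfrx.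
have := cf _ (rK _ Ax) _ Wfrx; rewrite /nbhs /= /within /= => /(cr _ Ax).
rewrite /nbhs /= /within /=; apply: filterS => y h Ay; apply: h => //.
exact: rK.
Qed.

Lemma continuous_comp_into (T U V : topologicalType) (K : set U) (r : T -> U)
    (f : U -> V) :
  continuous r -> (forall x, K (r x)) -> {within K, continuous f} ->
  continuous (f \o r).
Proof.
move=> cr rK cf; apply/continuous_subspace_setT.
apply: (@within_continuous_comp_sub _ _ _ setT K) => //.
exact: continuous_subspaceT.
Qed.

(** A closed C meets K in a compact set, and the preimage of C under [g] within the image of K is
    the image of that compact set, hence closed. *)
Lemma within_continuous_inverse (T U : topologicalType) (K : set T)
    (f : T -> U) (g : U -> T) :
  hausdorff_space U -> compact K -> {within K, continuous f} ->
  (forall x, K x -> g (f x) = x) -> {within f @` K, continuous g}.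
Proof.
move=> hU cK cf fK; apply/continuous_closedP => C cC.
apply/closed_subspaceP; exists (f @` (K `&` C)).
  apply: compact_closed => //; apply: continuous_compact.
    by apply: continuous_subspaceW cf => x [].
  exact: compact_closedI.
apply/seteqP; split=> y /=.
  by move=> [[x [Kx Cx] <-] _]; split; [rewrite /from_subspace fK | exists x].
by move=> [/= Cgy [x Kx xy]]; split; exists x => //; split => //; rewrite -[x]fK // xy.
Qed.

Lemma set_inj_inverse (T : choiceType) (U : Type) (x0 : T) (K : set T) (f : T -> U) :
  set_inj K f -> exists g : U -> T, forall x, K x -> g (f x) = x.
Proof.
move=> fi; exists (fun y => xget x0 [set x | K x /\ f x = y]) => x Kx.
case: xgetP => [z _ [Kz fzx]|/(_ x)]; first by apply: fi; rewrite ?inE.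
by move=> h; exfalso; apply: h.
Qed.

Section Plane.
Variable R : realType.
Implicit Types (p q : R * R) (d e : R).

Lemma norm_ltE p e : (`|p| < e) = (`|p.1| < e) && (`|p.2| < e).
Proof. by rewrite prod_normE gt_max. Qed.

Lemma norm_leE p e : (`|p| <= e) = (`|p.1| <= e) && (`|p.2| <= e).
Proof. by rewrite prod_normE ge_max. Qed.

Lemma box_compact (c : R * R) e : compact [set p | `|p - c| <= e].
Proof.
have -> : [set p | `|p - c| <= e] =
    `[c.1 - e, c.1 + e]%classic `*` `[c.2 - e, c.2 + e]%classic.
  apply/seteqP; split=> -[x y] /=; rewrite norm_leE /= !in_itv /=.
    by rewrite !ler_norml => /andP[/andP[? ?] /andP[? ?]]; split; lra.
  by move=> [/andP[? ?] /andP[? ?]]; rewrite !ler_norml; lra.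
by apply: compact_setX; exact: segment_compact.
Qed.

Lemma unif_continuous_on (U V : normedModType R) (h : U -> V) (K : set U) e :
  compact K -> continuous h -> 0 < e ->
  exists2 d : R, 0 < d & forall p q : U, K p -> `|p - q| < d -> `|h p - h q| < e.
Proof.
move=> /compact_near_coveringP cK ch e0.
have := cK _ (0^'+ : set_system R)
  (fun d (p : U) => forall q : U, `|p - q| < d -> `|h p - h q| < e) _ _.
case.
  move=> p Kp.
  have /cvgrPdist_lt /(_ (e / 2)) := ch p.
  rewrite divr_gt0 // => /(_ isT) /nbhs_ballP [d /= d0 hd].
  exists (ball p (d / 2), [set t | t < d / 2]) => /=.
    split; first by apply: nbhsx_ballx; rewrite divr_gt0.
    by apply: nbhs_right_lt; rewrite divr_gt0.
  move=> [q t] [/= qp td] r qr.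
  rewrite -ball_normE /= in qp.
  have h1 : `|h p - h q| < e / 2.
    by apply: hd; rewrite -ball_normE /=; apply: lt_trans qp _; lra.
  have h2 : `|h p - h r| < e / 2.
    apply: hd; rewrite -ball_normE /=.
    have -> : p - r = (p - q) + (q - r) by rewrite addrA subrK.
    by apply: le_lt_trans (ler_normD _ _) _; lra.
  have -> : h q - h r = (h p - h r) - (h p - h q).
    by rewrite opprB [RHS]addrC addrA subrK.
  by apply: le_lt_trans (ler_normB _ _) _; lra.
move=> d /= d0 hd; exists (d / 2); first by rewrite divr_gt0.
move=> p q Kp pq; apply: (hd (d / 2)) => //=.
  by rewrite sub0r normrN gtr0_norm ?divr_gt0 //; lra.
by rewrite divr_gt0.
Qed.

(** Without a zero, |h| is at least some m > 0 on the square. On a grid so fine that h varies by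
    less than m over a cell, colouring by the signs of the two components yields a cell with all
    three colours. *)
Lemma poincare_miranda (h : R * R -> R * R) : continuous h ->
  (forall y, `|y| <= 1 -> (h (-1, y)).1 < 0) ->
  (forall y, `|y| <= 1 -> 0 < (h (1, y)).1) ->
  (forall x, `|x| <= 1 -> (h (x, -1)).2 < 0) ->
  (forall x, `|x| <= 1 -> 0 < (h (x, 1)).2) ->
  exists2 p : R * R, `|p| <= 1 & h p = 0.
Proof.
move=> ch hL hR hB hT; apply: contrapT => hN0.
pose B := [set p : R * R | `|p - 0| <= 1].
have cB : compact B by exact: box_compact.
have [m m0 hm] : exists2 m : R, 0 < m & forall p, `|p| <= 1 -> m <= `|h p|.
  have [||/= c cB' hc] := @compact_EVT_min _ R (fun p => `|h p|) B _ cB.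
  - by exists 0; rewrite /B /= subr0 normr0.
  - apply: continuous_subspaceT => p; apply: continuous_comp; first exact: ch.
    exact: norm_continuous.
  - rewrite inE /B /= subr0 in cB'.
    exists `|h c| => [|p p1]; last by apply: hc; rewrite inE /B /= subr0.
    rewrite normr_gt0; apply/eqP => hc0; apply: hN0; exists c => //.
have [d d0 hd] := unif_continuous_on cB ch m0.
have [n nd] : exists n, 2 / n.+1%:R < d.
  exists (Num.bound (2 / d)).
  rewrite ltr_pdivrMr ?ltr0n // mulrC -ltr_pdivrMr //.
  have := archi_boundP (ltW (divr_gt0 (ltr0n R 2) d0)); move/lt_trans; apply.
  by rewrite ltr_nat.
pose N := n.+1; pose g i : R := -1 + i%:R * (2 / N%:R).
have N0 : 0 < N%:R :> R by rewrite ltr0n.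
have g0 : g 0%N = -1 by rewrite /g mul0r addr0.
have gN : g N = 1 by rewrite /g mulrCA divff ?gt_eqF //; lra.
have g1 i : (i <= N)%N -> `|g i| <= 1.
  move=> iN; rewrite ler_norml; apply/andP; split.
    by rewrite /g lerDl mulr_ge0 // divr_ge0 // ltW.
  have : g i <= g N by rewrite lerD2l ler_wpM2r ?ler_nat // divr_ge0 // ltW.
  by rewrite gN.
pose pt i j := (g i, g j).
have ptB i j : (i <= N)%N -> (j <= N)%N -> B (pt i j).
  by move=> iN jN; rewrite /B /= subr0 norm_leE /= !g1.
have [] := @sperner_grid N (fun i j => (h (pt i j)).1 < 0)
     (fun i j => (h (pt i j)).2 < 0).
- by move=> j jN; rewrite /pt g0 hL // g1.
- by move=> j jN; rewrite -leNgt /pt gN ltW // hR // g1.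
- by move=> i iN _; rewrite /pt g0 hB // g1.
- by move=> i iN _; rewrite -leNgt /pt gN ltW // hT // g1.
move=> i [j [iN jN [p [q [r [hp /andP[hq1 hq2] /andP[hr1 hr2]]]]]]].
rewrite -!leNgt in hq1 hr1 hr2.
have gd k (s t : bool) : `|g (k + s)%N - g (k + t)%N| < d.
  have -> : g (k + s)%N - g (k + t)%N = (s%:R - t%:R) * (2 / N%:R).
    by rewrite /g !natrD; lra.
  rewrite normrM (gtr0_norm (divr_gt0 _ N0)) //.
  apply: le_lt_trans nd; rewrite -[leRHS]mul1r ler_wpM2r ?divr_ge0 ?(ltW N0) //.
  by case: s t => [] []; rewrite /= ?subrr ?normr0 // ?subr0 ?sub0r ?normrN normr1.
have kN k (s : bool) : (k < N)%N -> (k + s <= N)%N.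
  by case: s; rewrite ?addn1 // addn0; apply: ltnW.
have near_pt (s t : bool * bool) :
  `|h (pt (i + s.1)%N (j + s.2)%N) - h (pt (i + t.1)%N (j + t.2)%N)| < m.
  by apply: hd; [apply: ptB; apply: kN | rewrite norm_ltE /= !gd].
(* At q the first component is nonnegative but becomes negative at p, the second is negative but
   becomes nonnegative at r; so both are smaller than m in absolute value. *)
have := hm (pt (i + q.1)%N (j + q.2)%N).
rewrite norm_leE /= !g1 ?kN // => /(_ isT); rewrite leNgt => /negP; apply.
rewrite norm_ltE; have := near_pt q p; have := near_pt q r.
rewrite !norm_ltE /= => /andP[_ qr] /andP[qp _].
rewrite (ger0_norm hq1) (ltr0_norm hq2).
move: qr qp; rewrite !ltr_norml => /andP[? ?] /andP[? ?].
by apply/andP; split; lra.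
Qed.

(** Compactness of the segment, for relations that hold locally and compose: the supremum of the
    points t with [Q a t] can be passed unless b is reached. *)
Lemma interval_induction (Q : R -> R -> Prop) a b : a <= b -> Q a a ->
  (forall s t r, a <= s -> s <= t -> t <= r -> r <= b -> Q s t -> Q t r -> Q s r) ->
  (forall x, a <= x <= b -> exists2 e : R, 0 < e &
    forall s t, x - e < s -> s <= t -> t < x + e -> Q s t) ->
  Q a b.
Proof.
move=> ab Qaa Qtr Qloc.
pose E := [set t | a <= t <= b /\ Q a t].
have Ea : E a by split => //; rewrite lexx.
have sE : has_sup E by split; [exists a | exists b => t [/andP[]]].
have Esup t : E t -> t <= sup E by move=> Et; apply: ub_le_sup => //; case: sE.
have asup : a <= sup E by exact: Esup.
have supb : sup E <= b by apply: ge_sup; [exists a | move=> t [/andP[]]].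
have [|e e0 he] := Qloc (sup E); first by rewrite asup.
have [t Et ht] := sup_adherent e0 sE.
have tsup := Esup _ Et; have [/andP[at_ tb] Qat] := Et.
(* Either r = b, which is the goal, or r belongs to E and lies beyond its supremum. *)
pose r := Num.min b (sup E + e / 2).
have tr : t <= r by rewrite le_min tb; lra.
have rb : r <= b by rewrite ge_min lexx.
have re : r <= sup E + e / 2 by rewrite ge_min lexx orbT.
have Qar : Q a r.
  by apply: (Qtr a t r) => //; apply: he => //; lra.
have Er : E r by split => //; rewrite rb (le_trans at_ tr).
have := Esup _ Er; move: Qar; rewrite /r minEle; case: ifP => // _ _.
by rewrite leNgt => /negP; case; lra.
Qed.

(** * Removing zeros on segments by small perturbations *)

Lemma continuous_minl (T : topologicalType) (f : T -> R) c :
  continuous f -> continuous (fun x => Num.min (f x) c).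
Proof.
move=> cf x; apply: (@continuous_min R T f (cst c)); first exact: cf.
exact: cst_continuous.
Qed.

Lemma continuous_maxl (T : topologicalType) (f : T -> R) c :
  continuous f -> continuous (fun x => Num.max (f x) c).
Proof.
move=> cf x; apply: (@continuous_max R T f (cst c)); first exact: cf.
exact: cst_continuous.
Qed.

Definition clamp a b x : R := Num.max (Num.min x b) a.

Lemma clamp_continuous a b : continuous (clamp a b).
Proof. by apply: continuous_maxl; apply: continuous_minl => x. Qed.

Lemma clamp_itv a b x : a <= b -> a <= clamp a b x <= b.
Proof.
by rewrite /clamp maxEle minEle => ab; do 2 case: ifPn; rewrite -?ltNge; lra.
Qed.

Lemma clamp_id a b x : a <= x <= b -> clamp a b x = x.
Proof.
by rewrite /clamp maxEle minEle => ab; do 2 case: ifPn; rewrite -?ltNge; lra.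
Qed.

(** The approximation is piecewise affine. Its values at the nodes are kept nonzero, so each affine
    piece has at most one zero. *)
Lemma approx_finite_zeros (u : R -> R) a b d :
  continuous u -> 0 < d -> a <= b ->
  exists w : R -> R, [/\ continuous w,
    forall t, a <= t <= b -> `|w t - u t| < d
    & exists zs : seq R, forall t, a <= t <= b -> w t = 0 -> t \in zs].
Proof.
move=> cu d0 ab.
have nzval x : exists2 z : R, z != 0 & `|z - u x| < d / 2.
  have [ux0|ux0] := eqVneq (u x) 0.
    exists (d / 4); first by rewrite gt_eqF //; lra.
    by rewrite ux0 subr0 gtr0_norm; lra.
  by exists (u x) => //; rewrite subrr normr0; lra.
(* Quantifying over all admissible end values lets neighbouring pieces be glued. The tolerance d / 2
   at the ends and the oscillation d / 4 on each side of x add up to at most d on an affine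
   piece. *)
pose Q s t := s < t -> forall ws wt : R, ws != 0 -> wt != 0 ->
  `|ws - u s| < d / 2 -> `|wt - u t| < d / 2 ->
  exists w : R -> R, [/\ continuous w, w s = ws, w t = wt,
    forall r, s <= r <= t -> `|w r - u r| < d
    & exists zs : seq R, forall r, s <= r <= t -> w r = 0 -> r \in zs].
have [a_b|ab'] := ltP a b; last first.
  have {ab ab'}-> : b = a by lra.
  have [z z0 hz] := nzval a.
  exists (cst z); split=> [x|t /andP[? ?]|]; first exact: cvg_cst.
    have -> : t = a by lra.
    by apply: lt_trans hz _; lra.
  by exists [::] => t _ /= z0'; rewrite z0' eqxx in z0.
suff /(_ a_b) Qab : Q a b.
  have [wa wa0 hwa] := nzval a; have [wb wb0 hwb] := nzval b.
  by have [w [cw _ _ h1 h2]] := Qab _ _ wa0 wb0 hwa hwb; exists w.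
apply: interval_induction => //.
- by rewrite /Q ltxx.
- move=> s t r _ st tr _ Qst Qtr sr ws wr ws0 wr0 hs hr.
  have [s_t|ts] := ltP s t; last first.
    have st' : s = t by lra.
    by subst t; exact: Qtr.
  have [t_r|rt] := ltP t r; last first.
    have st' : r = t by lra.
    by subst t; exact: Qst.
  have [wt wt0 ht] := nzval t.
  have [w1 [cw1 w1s w1t hw1 [z1 hz1]]] := Qst s_t _ _ ws0 wt0 hs ht.
  have [w2 [cw2 w2t w2r hw2 [z2 hz2]]] := Qtr t_r _ _ wt0 wr0 ht hr.
  (* Gluing at t in a form whose continuity needs no case distinction: one of the first two terms
     always equals [wt]. *)
  pose w x := w1 (Num.min x t) + w2 (Num.max x t) - wt.
  have wl x : x <= t -> w x = w1 x.
    by move=> xt; rewrite /w min_l // max_r // w2t addrK.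
  have wr' x : t <= x -> w x = w2 x.
    by move=> xt; rewrite /w min_r // max_l // w1t addrAC subrr add0r.
  exists w; split.
  + move=> x; apply: cvgB; last exact: cvg_cst.
    apply: cvgD; apply: continuous_comp; [|exact: cw1| |exact: cw2].
      by apply: continuous_minl => y.
    by apply: continuous_maxl => y.
  + by rewrite wl.
  + by rewrite wr'.
  + move=> x /andP[sx xr]; have [xt|tx] := leP x t.
      by rewrite wl // hw1 // sx.
    by rewrite wr' ?ltW // hw2 // xr ltW.
  + exists (z1 ++ z2) => x /andP[sx xr]; rewrite mem_cat; have [xt|tx] := leP x t.
      by rewrite wl // => wx; rewrite hz1 // sx.
    by rewrite wr' ?ltW // => wx; rewrite hz2 ?orbT // xr ltW.
- move=> x _.
  have /cvgrPdist_lt /(_ (d / 4)) := cu x.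
  rewrite divr_gt0 // => /(_ isT) /nbhs_ballP [e /= e0 he].
  exists e => // s t xs _ tx st ws wt ws0 wt0 hs ht.
  have near_ux r : s <= r <= t -> `|u x - u r| < d / 4.
    by move=> /andP[sr rt]; apply: he; rewrite -ball_normE /= ltr_norml; lra.
  pose k r := (r - s) / (t - s).
  have ts0 : 0 < t - s by lra.
  exists (fun r => ws + k r * (wt - ws)); split.
  + move=> r; apply: cvgD; first exact: cvg_cst.
    apply: cvgM; last exact: cvg_cst.
    apply: cvgM; last exact: cvg_cst.
    by apply: cvgB; [exact: cvg_id | exact: cvg_cst].
  + by rewrite /k subrr !mul0r addr0.
  + by rewrite /k divff ?gt_eqF // mul1r addrC subrK.
  + move=> r rst; have /andP[sr rt] := rst.
    have k0 : 0 <= k r by rewrite divr_ge0; lra.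
    have k1 : k r <= 1 by rewrite ler_pdivrMr //; lra.
    have := near_ux _ rst; have := near_ux s; have := near_ux t.
    rewrite !lexx (ltW st) => /(_ isT) + /(_ isT).
    move: hs ht; rewrite !ltr_norml.
    move=> /andP[? ?] /andP[? ?] /andP[? ?] /andP[? ?] /andP[? ?].
    have -> : ws + k r * (wt - ws) - u r =
       (1 - k r) * (ws - u r) + k r * (wt - u r) by lra.
    have [? ?] : - d < ws - u r /\ ws - u r < d by split; lra.
    have [? ?] : - d < wt - u r /\ wt - u r < d by split; lra.
    by apply/andP; split; nra.
  (* The only possible zero; if [ws = wt], the piece is a nonzero constant. *)
  + exists [:: s + (t - s) * ws / (ws - wt)] => r _ w0; rewrite inE; apply/eqP.
    have wst : ws - wt != 0.
      apply/eqP => h; move/eqP: ws0; apply; rewrite -w0.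
      have -> : wt - ws = 0 by lra.
      by rewrite mulr0 addr0.
    have : k r * (ws - wt) = ws by lra.
    move=> h; have {}h : ws / (ws - wt) = k r by rewrite -{1}h mulfK.
    by rewrite -mulrA h /k mulrCA divff ?gt_eqF //; lra.
Qed.

Lemma avoid_finite (s : seq R) d : 0 < d -> exists2 c : R, 0 < c < d & c \notin s.
Proof.
move=> d0.
suff [c0 c00 hc] : exists2 c0 : R, 0 < c0 &
    forall c, 0 < c < c0 -> c \notin s.
  pose c := Num.min c0 d / 2.
  have m0 : 0 < Num.min c0 d by rewrite lt_min c00.
  have mc : Num.min c0 d <= c0 by rewrite ge_min lexx.
  have md : Num.min c0 d <= d by rewrite ge_min lexx orbT.
  by exists c; [rewrite /c; lra | apply: hc; rewrite /c; lra].
elim: s => [|x s [c0 c00 hc]]; first by exists 1.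
have [x0|x0] := ltP 0 x.
  exists (Num.min c0 x); first by rewrite lt_min c00.
  move=> c; rewrite lt_min inE negb_or => /andP[c_0 /andP[cc0 cx]].
  by rewrite lt_eqF // hc // c_0.
exists c0 => // c c_0; rewrite inE negb_or hc // andbT.
by have /andP[? _] := c_0; rewrite gt_eqF //; lra.
Qed.

(** A stand-in for K having dimension at most one: maps to the plane can be moved off 0 on K. The
    bound on the perturbation is global, so that perturbations for several sets can be composed. *)
Definition perturbable (K : set (R * R)) := forall (g : R * R -> R * R) d,
  continuous g -> 0 < d -> exists h : R * R -> R * R, [/\ continuous h,
    forall p, `|h p - g p| <= d & forall p, K p -> h p != 0].

(** Along the segment the first component is given finitely many zeros; a small shift c of the
    second component then avoids 0 at each of them. *)
Lemma horizontal_perturbable a b y0 : a <= b ->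
  perturbable [set p | a <= p.1 <= b /\ p.2 = y0].
Proof.
move=> ab g d cg d0.
have cu : continuous (fun x => (g (x, y0)).1).
  apply: continuous_fst => x; apply: continuous_comp; last exact: cg.
  apply: (@continuous_pair _ _ _ id (cst y0)) => ?; first exact: cvg_id.
  exact: cst_continuous.
have [w [cw hw [zs hzs]]] := approx_finite_zeros cu d0 ab.
have [c c0d hc] := avoid_finite [seq - (g (x, y0)).2 | x <- zs] d0.
pose k x := clamp a b x.
(* The correction depends on p only through its clamped first coordinate, so it is continuous and
   bounded by d on the whole plane. *)
exists (fun p => g p + (w (k p.1) - (g (k p.1, y0)).1, c)); split.
- move=> p; apply: cvgD; first exact: cg.
  move: p; apply: continuous_pair => p; last exact: cst_continuous.
  apply: (@continuous_comp _ _ _ (fun p => k p.1) (fun x => w x - (g (x, y0)).1)).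
    apply: continuous_comp; [exact: cvg_fst|exact: clamp_continuous].
  by apply: cvgB; [exact: cw | exact: cu].
- move=> p; rewrite addrAC subrr add0r norm_leE /= ltW ?hw ?clamp_itv //=.
  by rewrite gtr0_norm; lra.
- move=> [x y] [/= xab ->]; apply/eqP => -[]; rewrite /k clamp_id //.
  rewrite addrC subrK => wx0 cx.
  move/negP: hc; apply; apply/mapP; exists x; first exact: hzs.
  by move: cx => /eqP; rewrite addrC addr_eq0 => /eqP.
Qed.

Lemma swap_perturbable K : perturbable K -> perturbable [set p | K (p.2, p.1)].
Proof.
move=> hK g d cg d0; pose s (p : R * R) := (p.2, p.1).
have cs : continuous s.
  by apply: continuous_pair => p; [exact: cvg_snd | exact: cvg_fst].
have [|h [ch hg h0]] := hK (g \o s) d _ d0.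
  by move=> p; apply: continuous_comp; [exact: cs | exact: cg].
exists (h \o s); split=> [p|p|p Kp]; last exact: h0.
  by apply: continuous_comp; [exact: cs | exact: ch].
by have := hg (s p); rewrite /s /=; case: p.
Qed.

Lemma nonzero_lower_bound (g : R * R -> R * R) (K : set (R * R)) :
  compact K -> continuous g -> (forall p, K p -> g p != 0) ->
  exists2 m : R, 0 < m & forall p, K p -> m <= `|g p|.
Proof.
move=> cK cg g0; have [K0|/nonemptyPn K0] := pselect (K !=set0); last first.
  by exists 1 => // p; rewrite K0.
have [||/= c Kc hc] := @compact_EVT_min _ R (fun p => `|g p|) K _ cK => //.
  apply: continuous_subspaceT => p; apply: continuous_comp; first exact: cg.
  exact: norm_continuous.
rewrite inE in Kc; exists `|g c|; first by rewrite normr_gt0 g0.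
by move=> p Kp; apply: hc; rewrite inE.
Qed.

(** A perturbation of at most half a positive lower bound of |g| on A creates no zero there. *)
Lemma perturb_keep (K A : set (R * R)) (g : R * R -> R * R) d :
  perturbable K -> compact A -> continuous g -> 0 < d ->
  (forall p, A p -> g p != 0) -> exists h : R * R -> R * R, [/\ continuous h,
    forall p, `|h p - g p| <= d & forall p, (A `|` K) p -> h p != 0].
Proof.
move=> hK cA cg d0 gA; have [m m0 hm] := nonzero_lower_bound cA cg gA.
have [|h [ch hg h0]] := hK g (Num.min d (m / 2)) cg.
  by rewrite lt_min d0 divr_gt0.
exists h; split=> // [p|p [Ap|]]; last exact: h0.
  by apply: le_trans (hg p) _; rewrite ge_min lexx.
apply/eqP => hp0; have := hg p; rewrite hp0 sub0r normrN le_min => /andP[_].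
by have := hm _ Ap; lra.
Qed.

Lemma perturbableU (K1 K2 : set (R * R)) :
  compact K1 -> perturbable K1 -> perturbable K2 -> perturbable (K1 `|` K2).
Proof.
move=> c1 p1 p2 g d cg d0.
have d2 : 0 < d / 2 by lra.
have [h [ch hg h0]] := p1 g _ cg d2.
have [k [ck kh k0]] := perturb_keep p2 c1 ch d2 h0.
exists k; split=> // p.
have -> : k p - g p = (k p - h p) + (h p - g p) by rewrite addrA subrK.
by apply: le_trans (ler_normD _ _) _; have := kh p; have := hg p; lra.
Qed.

(** In the max norm a sphere is the boundary of a square, a union of four segments. *)
Lemma box_sphere_perturbable (c : R * R) e : 0 < e ->
  perturbable [set p | `|p - c| = e].
Proof.
move=> e0.
pose H y0 := [set p : R * R | c.1 - e <= p.1 <= c.1 + e /\ p.2 = y0].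
pose W x0 := [set p : R * R | c.2 - e <= p.2 <= c.2 + e /\ p.1 = x0].
have pH y0 : perturbable (H y0) by apply: horizontal_perturbable; lra.
have pW x0 : perturbable (W x0).
  have h : c.2 - e <= c.2 + e by lra.
  have := swap_perturbable (@horizontal_perturbable _ _ x0 h).
  exact.
have cH y0 : compact (H y0).
  have -> : H y0 = `[c.1 - e, c.1 + e]%classic `*` [set y0].
    by apply/seteqP; split=> -[x y]; rewrite /H /= in_itv.
  by apply: compact_setX; [exact: segment_compact | exact: compact_set1].
have cW x0 : compact (W x0).
  have -> : W x0 = [set x0] `*` `[c.2 - e, c.2 + e]%classic.
    by apply/seteqP; split=> -[x y]; rewrite /W /= in_itv => -[].
  by apply: compact_setX; [exact: compact_set1 | exact: segment_compact].
have key := perturbableU (cH (c.2 - e)) (pH _) (perturbableU (cH (c.2 + e)) (pH _)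
   (perturbableU (cW (c.1 - e)) (pW _) (pW (c.1 + e)))).
move=> g d cg d0; have [h [ch hg h0]] := key g d cg d0.
exists h; split=> // -[x y] /= pe; apply: h0.
have : `|(x, y) - c| <= e by rewrite pe.
have : ~~ (`|(x, y) - c| < e) by rewrite pe ltxx.
rewrite norm_leE norm_ltE negb_and -!leNgt /= !ler_norml !ler_normr.
move=> + /andP[/andP[? ?] /andP[? ?]].
case/orP=> /orP[?|?].
- by right; right; right; rewrite /W /=; split; lra.
- by right; right; left; rewrite /W /=; split; lra.
- by right; left; rewrite /H /=; split; lra.
- by left; rewrite /H /=; split; lra.
Qed.

Lemma tietze_plane (X : set (R * R)) (g : R * R -> R * R) : closed X ->
  {within X, continuous g} -> (forall p, X p -> `|g p| <= 1) ->
  exists2 h : R * R -> R * R, continuous h & forall p, X p -> h p = g p.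
Proof.
move=> cX cg g1.
have nP : normal_space (R * R)%type by exact: (@pseudometric_normal R).
have [|p /g1|h1 [e1 c1 _]] :=
  @continuous_bounded_extension _ R nP X cX (fun p => (g p).1) 1 ltr01.
- exact: continuous_fst cg.
- by rewrite norm_leE => /andP[].
have [|p /g1|h2 [e2 c2 _]] :=
  @continuous_bounded_extension _ R nP X cX (fun p => (g p).2) 1 ltr01.
- exact: continuous_snd cg.
- by rewrite norm_leE => /andP[].
exists (fun p => (h1 p, h2 p)); first exact: continuous_pair.
by move=> p Xp; rewrite -e1 ?inE // -e2 ?inE //; case: (g p).
Qed.

(* The radial push away from [c], followed by an approximate inverse of [f]
   without zeros on the pushed image, would contradict Poincare-Miranda. *)
Lemma invariance_of_domain_unit (f : R * R -> R * R) :
  {within [set p | `|p| <= 1], continuous f} ->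
  set_inj [set p | `|p| <= 1] f -> nbhs (f 0) (f @` [set p | `|p| <= 1]).
Proof.
set B := [set p : R * R | `|p| <= 1]; move=> cf fi; apply: contrapT => nf.
have BE : B = [set p | `|p - 0| <= 1] by apply/seteqP; split=> p; rewrite /B /= subr0.
have cB : compact B by rewrite BE; exact: box_compact.
have B0 : B 0 by rewrite /B /= normr0.
have [g gf] := set_inj_inverse 0 fi.
have hR2 : hausdorff_space (R * R)%type by exact: norm_hausdorff.
have cgX := within_continuous_inverse hR2 cB cf gf.
set X := f @` B in cgX nf.
have cX : compact X by exact: continuous_compact.
have clX : closed X by exact: compact_closed.
have [|G cG GX] := tietze_plane clX cgX.
  by move=> _ [p Bp <-]; rewrite gf.
have Gf p : B p -> G (f p) = p by move=> Bp; rewrite GX ?gf //; exists p.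
(* The point c will be within e of f 0, so points within e of c are within 2 e of f 0, where |G| < 1
   / 8. *)
have [e e0 he] : exists2 e : R, 0 < e &
    forall y : R * R, `|f 0 - y| < 2 * e -> `|G y| < 1 / 8.
  have /cvgrPdist_lt /(_ (1 / 8)) := cG (f 0).
  rewrite divr_gt0 // => /(_ isT) /nbhs_ballP [e /= e0 he].
  exists (e / 2) => [|y fy]; first lra.
  have := he y; rewrite -ball_normE /= Gf // sub0r normrN; apply.
  by move: fy; lra.
have [c cf0 cNX] : exists2 c : R * R, `|f 0 - c| < e & ~ X c.
  apply: contrapT => h; apply: nf; apply/nbhs_ballP; exists e => //= y.
  rewrite -ball_normE /= => fy; apply: contrapT => Xy; apply: h.
  by exists y.
(* G has no zero here: its only zero on X is f 0, which is closer than e to c. *)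
pose A := X `&` [set y | e <= `|y - c|].
have cA : compact A.
  apply: compact_closedI => //.
  have -> : [set y : R * R | e <= `|y - c|] =
      (fun y : R * R => `|y - c|) @^-1` [set r | e <= r] by [].
  apply: closed_comp; last exact: closed_ge.
  move=> y _; apply: cvg_norm; apply: cvgB; first exact: cvg_id.
  exact: cvg_cst.
have GA p : A p -> G p != 0.
  move=> [[b Bb <-] /= ec]; rewrite Gf //; apply/eqP => b0.
  by move: ec; rewrite b0 leNgt cf0.
have d0 : 0 < 1 / 8 :> R by lra.
have [P [cP PG P0]] := perturb_keep (@box_sphere_perturbable c _ e0) cA cG d0 GA.
(* Retraction onto the unit square, because Poincare-Miranda is applied to a map continuous on the
   whole plane. *)
pose r (p : R * R) := (clamp (-1) 1 p.1, clamp (-1) 1 p.2).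
have cr : continuous r.
  by apply: continuous_pair => p; apply: continuous_comp;
    [exact: cvg_fst | exact: clamp_continuous | exact: cvg_snd
    | exact: clamp_continuous].
have rB p : B (r p).
  rewrite /B /= norm_leE /r /= !ler_norml.
  by rewrite !clamp_itv //; lra.
have rid p : B p -> r p = p.
  rewrite /B /= norm_leE !ler_norml => /andP[h1 h2].
  by rewrite /r !clamp_id //; case: p {h1 h2}.
have cfr : continuous (f \o r) by exact: continuous_comp_into cf.
(* Points closer than e to c go to the sphere of radius e about c, all others stay fixed; the centre
   c is not in X. *)
pose phi (y : R * R) : R * R := c + Num.max (e / `|y - c|) 1 *: (y - c).
have nc p : `|f (r p) - c| != 0.
  rewrite normr_eq0 subr_eq0; apply/eqP => h; apply: cNX; rewrite -h.
  by exists (r p).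
have cphi : continuous (phi \o (f \o r)).
  move=> p; apply: cvgD; first exact: cvg_cst.
  have cd : continuous (fun p => f (r p) - c).
    by move=> q; apply: cvgB; [exact: cfr | exact: cvg_cst].
  apply: cvgZ; last exact: cd.
  move: p; apply: (@continuous_maxl _ (fun p => e / `|f (r p) - c|) 1) => q.
  apply: cvgM; first exact: cvg_cst.
  apply: cvgV; first exact: nc.
  by apply: cvg_norm; exact: cd.
have phi_far y : e <= `|y - c| -> phi y = y.
  move=> ey; rewrite /phi max_r ?scale1r; first by rewrite addrC subrK.
  by rewrite ler_pdivrMr ?mul1r //; lra.
have phi_near y : 0 < `|y - c| -> `|y - c| < e -> `|phi y - c| = e.
  move=> y0 ye; rewrite /phi addrAC subrr add0r normrZ max_l; last first.
    by rewrite ler_pdivlMr // mul1r ltW.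
  by rewrite gtr0_norm ?divr_gt0 // divfK // gt_eqF.
pose h p := P (phi (f (r p))).
have ch : continuous h.
  move=> p; apply: (@continuous_comp _ _ _ (phi \o (f \o r))); first exact: cphi.
  exact: cP.
(* At a far point only P - G contributes, at most 1 / 8; at a near one P - G, G and p contribute at
   most 1 / 8 each. As 3 / 8 < 1, the signs of h on the sides are those of the identity. *)
have hb p : B p -> `|h p - p| <= 3 / 8.
  move=> Bp; rewrite /h (rid _ Bp).
  have [far|near_c] := leP e `|f p - c|.
    by rewrite phi_far // -{2}(Gf _ Bp); have := PG (f p); lra.
  have c0 : 0 < `|f p - c|.
    by rewrite lt_neqAle eq_sym normr_ge0 andbT -{1}(rid _ Bp) nc.
  have e1 := phi_near _ c0 near_c.
  have G1 : `|G (phi (f p))| < 1 / 8.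
    apply: he; have -> : f 0 - phi (f p) = (f 0 - c) - (phi (f p) - c).
      by rewrite opprB addrA subrK.
    by apply: le_lt_trans (ler_normB _ _) _; lra.
  have G2 : `|p| < 1 / 8.
    rewrite -(Gf _ Bp); apply: he.
    have -> : f 0 - f p = (f 0 - c) - (f p - c) by rewrite opprB addrA subrK.
    by apply: le_lt_trans (ler_normB _ _) _; lra.
  have -> : P (phi (f p)) - p = (P (phi (f p)) - G (phi (f p))) + G (phi (f p)) - p.
    by rewrite subrK.
  apply: le_trans (ler_normB _ _) _.
  have := ler_normD (P (phi (f p)) - G (phi (f p))) (G (phi (f p))).
  by have := PG (phi (f p)); lra.
have h_near x y : `|x| <= 1 -> `|y| <= 1 ->
    [/\ x - 3 / 8 <= (h (x, y)).1, (h (x, y)).1 <= x + 3 / 8,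
     y - 3 / 8 <= (h (x, y)).2 & (h (x, y)).2 <= y + 3 / 8].
  move=> x1 y1; have := hb (x, y); rewrite /B /= norm_leE /= x1 y1 => /(_ isT).
  by rewrite norm_leE /= !ler_norml => /andP[/andP[? ?] /andP[? ?]]; split; lra.
have n1 : `|1| <= 1 :> R by rewrite normr1.
have nN1 : `|-1| <= 1 :> R by rewrite normrN normr1.
have [||||p p1 hp0] := poincare_miranda ch.
- by move=> y y1; have [_ ? _ _] := h_near _ _ nN1 y1; lra.
- by move=> y y1; have [? _ _ _] := h_near _ _ n1 y1; lra.
- by move=> x x1; have [_ _ _ ?] := h_near _ _ x1 nN1; lra.
- by move=> x x1; have [_ _ ? _] := h_near _ _ x1 n1; lra.
have := P0 (phi (f (r p))); rewrite -/(h p) hp0 eqxx => nP; apply: notF; apply: nP.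
have Xp : X (f (r p)) by exists (r p).
have [far|near_c] := leP e `|f (r p) - c|; first by left; rewrite phi_far.
by right; rewrite /= phi_near // lt_neqAle eq_sym normr_ge0 andbT nc.
Qed.

Lemma invariance_of_domain (f : R * R -> R * R) (a : R * R) e : 0 < e ->
  {within [set p | `|p - a| <= e], continuous f} ->
  set_inj [set p | `|p - a| <= e] f ->
  nbhs (f a) (f @` [set p | `|p - a| <= e]).
Proof.
move=> e0 cf fi; pose s (p : R * R) : R * R := a + e *: p.
have sB p : `|p| <= 1 -> `|s p - a| <= e.
  move=> p1; rewrite /s addrAC subrr add0r normrZ gtr0_norm //.
  by rewrite -[leRHS]mulr1 ler_pM2l.
have := @invariance_of_domain_unit (f \o s); rewrite /= /s scaler0 addr0.
move=> h; apply: filterS (h _ _).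
- by move=> _ [p p1 <-]; exists (s p) => //; exact: sB.
- apply: (@within_continuous_comp_sub _ _ _ [set p | `|p| <= 1] _ s f _ sB cf).
  apply: continuous_subspaceT => p; apply: cvgD; first exact: cvg_cst.
  by apply: cvgZ; [exact: cvg_cst | exact: cvg_id].
- move=> p q; rewrite !inE /= => p1 q1 fpq.
  have /addrI : s p = s q by apply: fi; rewrite ?inE //=; exact: sB.
  by apply: scalerI; rewrite gt_eqF.
Qed.

End Plane.

(** * Disks and surfaces *)

Section Disk.
Variable R : realType.
Implicit Types (p q b : R * R) (e s : R).

Let sqn p : R := p.1 ^+ 2 + p.2 ^+ 2.

Lemma sqnorm_continuous : continuous sqn.
Proof.
move=> p; apply: cvgD; rewrite expr2; apply: cvgM;
  by [exact: cvg_fst | exact: cvg_snd].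
Qed.

Lemma closed_disk_compact : compact (@closed_disk R).
Proof.
apply: (@subclosed_compact _ _ [set p | `|p - 0| <= 1]).
- have -> : @closed_disk R = sqn @^-1` [set r | r <= 1] by [].
  by apply: closed_comp; [move=> p _; exact: sqnorm_continuous | exact: closed_le].
- exact: box_compact.
- move=> [x y] /= h; rewrite subr0 norm_leE /= !ler_norml.
  have := sqr_ge0 x; have := sqr_ge0 y.
  by move: h; rewrite /closed_disk /= => *; apply/andP; split; nra.
Qed.

Lemma open_disk_open : open (@open_disk R).
Proof.
have -> : @open_disk R = sqn @^-1` [set r | r < 1] by [].
by apply: open_comp; [move=> p _; exact: sqnorm_continuous | exact: open_lt].
Qed.

Lemma closed_diskE : @closed_disk R = @open_disk R `|` @unit_circle R.
Proof.
apply/seteqP; split=> p; rewrite /closed_disk /open_disk /unit_circle /=.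
  by rewrite le_eqVlt => /orP[/eqP|]; [right | left].
by case=> [/ltW //|->].
Qed.

Lemma scale_disk b s : @unit_circle R b -> 0 < s <= 1 ->
  @open_disk R ((1 - s) *: b).
Proof.
rewrite /unit_circle /open_disk /= => h s01.
have -> : ((1 - s) * b.1) ^+ 2 + ((1 - s) * b.2) ^+ 2 = (1 - s) ^+ 2.
  by rewrite !exprMn -mulrDr h mulr1.
by nra.
Qed.

Lemma circle_not_interior b : @unit_circle R b -> ~ nbhs b (@closed_disk R).
Proof.
move=> hb; have cs : continuous (fun s : R => (1 + s) *: b).
  move=> s; apply: cvgZ; last exact: cvg_cst.
  by apply: cvgD; [exact: cvg_cst | exact: cvg_id].
move=> nb; have := cs 0; rewrite /continuous_at addr0 scale1r => /(_ _ nb).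
move=> /nbhs_ballP [e /= e0 he].
have := he (e / 2); rewrite -ball_normE /= sub0r normrN gtr0_norm; last lra.
have e2 : e / 2 < e by lra.
move=> /(_ e2); move: hb; rewrite /unit_circle /closed_disk /= => h.
rewrite !exprMn -mulrDr h mulr1; nra.
Qed.

Lemma polar_inj (s s' : R) (u u' : R * R) :
  @unit_circle R u -> @unit_circle R u' -> 0 < s -> 0 < s' ->
  s *: u = s' *: u' -> s = s' /\ u = u'.
Proof.
rewrite /unit_circle /= => cu cu' s0 s0' [uu1 uu2].
have {}uu1 : s * u.1 = s' * u'.1 := uu1.
have {}uu2 : s * u.2 = s' * u'.2 := uu2.
have ss : s = s'.
  have : s ^+ 2 = s' ^+ 2.
    rewrite -[LHS]mulr1 -[RHS]mulr1 -{1}cu -cu' !mulrDr -!exprMn.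
    by rewrite uu1 uu2.
  by move/eqP; rewrite eqrXn2 ?ltW // => /eqP.
split=> //; move: uu1 uu2; rewrite -ss.
have sN0 : s != 0 by rewrite gt_eqF.
move=> /(mulfI sN0) h1 /(mulfI sN0) h2.
by case: u u' h1 h2 {cu cu'} => [? ?] [? ?] /= -> ->.
Qed.

Lemma ball_box p e : ball p e = [set q | `|p - q| < e].
Proof. by rewrite -ball_normE. Qed.

Lemma nbhs_box p (N : set (R * R)) : nbhs p N ->
  exists2 e : R, 0 < e & [set q | `|q - p| <= e] `<=` N.
Proof.
move=> /nbhs_ballP [e /= e0 he]; exists (e / 2) => [|q /= qp]; first lra.
by apply: he; rewrite ball_box /= distrC; lra.
Qed.

Lemma box_nbhs p e : 0 < e -> nbhs p [set q | `|q - p| <= e].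
Proof.
move=> e0; apply/nbhs_ballP; exists e => //= q; rewrite ball_box /= distrC.
exact: ltW.
Qed.

Lemma segments_connected (A : set (R * R)) a : A a ->
  (forall p (t : R), A p -> 0 <= t <= 1 -> A (a + t *: (p - a))) -> connected A.
Proof.
move=> Aa hA; pose seg p := (fun t : R => a + t *: (p - a)) @` `[0, 1]%classic.
have -> : A = \bigcup_(p in A) seg p.
  apply/seteqP; split=> q; last first.
    by move=> [p Ap [t /= t01 <-]]; apply: hA => //; rewrite in_itv in t01.
  move=> Aq; exists q => //; exists 1; first by rewrite /= in_itv /= lexx ler01.
  by rewrite scale1r addrC subrK.
apply: bigcup_connected.
  exists a => p _; exists 0; first by rewrite /= in_itv /= lexx ler01.
  by rewrite scale0r addr0.
move=> p _; apply: connected_continuous_connected; first exact: segment_connected.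
apply: continuous_subspaceT => t; apply: cvgD; first exact: cvg_cst.
by apply: cvgZ; [exact: cvg_id | exact: cvg_cst].
Qed.

(** The punctured square is the union of four half-squares, each convex and overlapping the next one
    around the centre. *)
Lemma punctured_box_connected (c : R * R) e : 0 < e ->
  connected [set p | `|p - c| < e /\ p <> c].
Proof.
move=> e0.
pose H (k : R * R -> R) := [set p | `|p - c| < e] `&` [set p | 0 < k (p - c)].
pose k1 (p : R * R) : R := p.1; pose k2 (p : R * R) : R := - p.1.
pose k3 (p : R * R) : R := p.2; pose k4 (p : R * R) : R := - p.2.
have cH (k : R * R -> R) (a : R * R) : H k a ->
    (forall t x, k (t *: x) = t * k x) -> (forall x y, k (x + y) = k x + k y) ->
    connected (H k).
  move=> Ha kZ kD; apply: (segments_connected Ha) => p t [/= p1 p2] t01.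
  case: Ha => /= a1 a2.
  have -> : a + t *: (p - a) = c + ((1 - t) *: (a - c) + t *: (p - c)).
    have zE (u : R) (x : R * R) : u *: x = (u * x.1, u * x.2) by case: x.
    by rewrite !zE; apply: injective_projections => /=; lra.
  split; rewrite /= addrAC subrr add0r.
    apply: le_lt_trans (ler_normD _ _) _; rewrite !normrZ !ger0_norm; try lra.
    have [t0|t0] := eqVneq t 0; first by rewrite t0; lra.
    by have : 0 < t by [rewrite lt_neqAle eq_sym t0; lra]; nra.
  rewrite kD !kZ; have [t0|t0] := eqVneq t 0; first by rewrite t0; lra.
  by have : 0 < t by [rewrite lt_neqAle eq_sym t0; lra]; nra.
have inH x y (k : R * R -> R) : `|x| < e -> `|y| < e -> 0 < k (x, y) ->
    H k (c + (x, y)).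
  move=> xe ye kxy; split; rewrite /= addrAC subrr add0r //.
  by rewrite norm_ltE /= xe ye.
have he : 0 < e / 2 by lra.
have n2 : `|e / 2| < e by rewrite gtr0_norm //; lra.
have nN2 : `|- (e / 2)| < e by rewrite normrN.
have h1 : connected (H k1).
  by apply: (cH _ (c + (e / 2, e / 2))) => //; exact: inH.
have h2 : connected (H k2).
  apply: (cH _ (c + (- (e / 2), e / 2))); first by apply: inH; rewrite /k2 //= opprK.
    by move=> t x; rewrite /k2 /= mulrN.
  by move=> x y; rewrite /k2 /= opprD.
have h3 : connected (H k3).
  by apply: (cH _ (c + (e / 2, e / 2))) => //; exact: inH.
have h4 : connected (H k4).
  apply: (cH _ (c + (e / 2, - (e / 2)))); first by apply: inH; rewrite /k4 //= opprK.
    by move=> t x; rewrite /k4 /= mulrN.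
  by move=> x y; rewrite /k4 /= opprD.
have -> : [set p | `|p - c| < e /\ p <> c] = ((H k1 `|` H k3) `|` H k2) `|` H k4.
  apply/seteqP; split=> [p [/= p1 /eqP pc]|p]; last first.
    have nH (k : R * R -> R) : k 0 = 0 -> H k p -> `|p - c| < e /\ p <> c.
      move=> k0 [/= pe kp]; split => // pc.
      by move: kp; rewrite pc subrr k0 ltxx.
    by move=> [[[]|]|]; apply: nH; rewrite /k1 /k2 /k3 /k4 /= ?oppr0.
  rewrite -subr_eq0 in pc; have : ((p - c).1 != 0) || ((p - c).2 != 0).
    by rewrite -negb_and; apply: contra pc => /andP[/eqP u /eqP w]; apply/eqP;
      move: u w; case: (p - c) => ? ? /= -> ->.
  case/orP; rewrite neq_lt => /orP[lt0|gt0].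
  - by left; right; split => //=; rewrite /k2 oppr_gt0.
  - by left; left; left; split.
  - by right; split => //=; rewrite /k4 oppr_gt0.
  - by left; left; right; split.
apply: connectedU => //; last apply: connectedU => //; last apply: connectedU => //.
- exists (c + (e / 2, - (e / 2))); split; last first.
    by apply: inH; rewrite /k4 //= opprK.
  by left; left; apply: inH.
- exists (c + (- (e / 2), e / 2)); split; last first.
    by apply: inH; rewrite /k2 //= opprK.
  by right; apply: inH.
- by exists (c + (e / 2, e / 2)); split; apply: inH.
Qed.

End Disk.

Section Surface.
Variables (R : realType) (S : topologicalType).
Hypothesis surfS : is_surface R S.
Implicit Types (p q : R * R) (x : S) (N : set S).

Let hausS : hausdorff_space S. Proof. by case: surfS. Qed.

Lemma surface_chart x N : nbhs x N -> exists (phi : R * R -> S) (a : R * R) (e : R),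
  [/\ 0 < e, phi a = x, {within [set p | `|p - a| <= e], continuous phi},
      set_inj [set p | `|p - a| <= e] phi
    & phi @` [set p | `|p - a| <= e] `<=` N] /\
  nbhs x (phi @` [set p | `|p - a| < e]).
Proof.
move=> Nx; have [_ _ /(_ x) [U [oU Ux [psi [phi [cpsi cphi h1 h2]]]]]] := surfS.
have [Da phia] := h1 _ Ux; pose a := psi x.
have cphia : phi @ a --> x.
  have := cphi; rewrite continuous_open_subspace; last exact: open_disk_open.
  by move=> /(_ a); rewrite inE /continuous_at phia; apply.
have : nbhs a (@open_disk R `&` phi @^-1` N).
  apply: filterI; last exact: cphia.
  by apply: open_nbhs_nbhs; split => //; exact: open_disk_open.
move=> /nbhs_box [e e0 he]; exists phi, a, e; split; first split => //.
- by apply: continuous_subspaceW cphi => p /he [].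
- move=> p q; rewrite !inE => /he [Dp _] /he [Dq _] pq.
  by have [_ <-] := h2 _ Dp; have [_ <-] := h2 _ Dq; rewrite pq.
- by move=> _ [p /he [_ Np] <-].
have cpsix : psi @ x --> a.
  by have := cpsi; rewrite continuous_open_subspace // => /(_ x); rewrite inE; apply.
have : nbhs x (U `&` psi @^-1` [set p | `|p - a| < e]).
  apply: filterI; first by apply: open_nbhs_nbhs.
  apply: cpsix; apply/nbhs_ballP; exists e => //= q.
  by rewrite ball_box /= distrC.
apply: filterS => y [Uy /= ye]; exists (psi y) => //.
by have [] := h1 _ Uy.
Qed.

Lemma surface_invariance_of_domain (h : R * R -> S) (a : R * R) (e : R) : 0 < e ->
  {within [set p | `|p - a| <= e], continuous h} ->
  set_inj [set p | `|p - a| <= e] h ->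
  nbhs (h a) (h @` [set p | `|p - a| <= e]).
Proof.
move=> e0 ch hi.
have [_ _ /(_ (h a)) [U [oU Ux [psi [phi [cpsi _ h1 _]]]]]] := surfS.
have cpsix y : U y -> psi @ y --> psi y.
  by move=> Uy; have := cpsi; rewrite continuous_open_subspace // => /(_ y);
    rewrite inE; apply.
(* The chart [psi] is controlled only on U, so the square is shrunk until h maps it into U. *)
have nU : nbhs a (h @^-1` U).
  move/subspace_continuousP: ch => /(_ a); rewrite /= subrr normr0 ltW // => /(_ isT).
  move=> /(_ U); rewrite /nbhs /= => hU.
  have /hU : nbhs (h a) U by apply: open_nbhs_nbhs.
  rewrite /within /= => w; near=> q.
  by apply: (near w q) => //; near: q; exact: box_nbhs.
have [e' e'0 he'] := nbhs_box nU.
pose d := Num.min e e'; have d0 : 0 < d by rewrite lt_min e0.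
have de : [set p | `|p - a| <= d] `<=` [set p | `|p - a| <= e].
  by move=> p /=; rewrite le_min => /andP[].
have dU p : `|p - a| <= d -> U (h p).
  by rewrite le_min => /andP[_ pe]; exact: he'.
have : nbhs (psi (h a)) ((psi \o h) @` [set p | `|p - a| <= d]).
  apply: (invariance_of_domain d0).
- apply: (@within_continuous_comp_sub _ _ _ _ U h psi _ dU cpsi).
  exact: continuous_subspaceW ch.
- move=> p q; rewrite !inE => pd qd /= pq.
  apply: hi; rewrite ?inE; [exact: de | exact: de |].
  have [_ <-] := h1 _ (dU _ pd); have [_ <-] := h1 _ (dU _ qd).
  by rewrite pq.
move=> /(cpsix _ Ux) nI.
have {}nI : nbhs (h a) (psi @^-1` ((psi \o h) @` [set p | `|p - a| <= d])) := nI.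
have nU' : nbhs (h a) U by apply: open_nbhs_nbhs.
apply: filterS2 nI nU' => y [p /= pd pq] Uy; exists p; first exact: de.
by have [_ <-] := h1 _ Uy; have [_ <-] := h1 _ (dU _ pd); rewrite pq.
Unshelve. all: by end_near.
Qed.

(** Otherwise a chart square around f b lies in the image; followed by the inverse of f it embeds in
    the closed disk, and invariance of domain makes b an interior point of the disk. *)
Lemma disk_boundary_not_nbhs (f : R * R -> S) b :
  {within @closed_disk R, continuous f} -> set_inj (@closed_disk R) f ->
  @unit_circle R b -> ~ nbhs (f b) (f @` @closed_disk R).
Proof.
move=> cf fi ub /surface_chart [phi [a [e [[e0 pa cphi phii phiN] _]]]].
have [g gf] := set_inj_inverse (0 : R * R) fi.
have Db : @closed_disk R b by rewrite closed_diskE; right.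
have cg := within_continuous_inverse hausS (@closed_disk_compact R) cf gf.
have inD p : `|p - a| <= e -> (f @` @closed_disk R) (phi p).
  by move=> pe; apply: phiN; exists p.
have : nbhs (g (phi a)) ((g \o phi) @` [set p | `|p - a| <= e]).
  apply: (invariance_of_domain (f := g \o phi) e0).
    exact: (@within_continuous_comp_sub _ _ _ _ _ phi g cphi inD cg).
  move=> p q; rewrite !inE => /= pe qe pq; apply: phii; rewrite ?inE //.
  have [p' Dp' pp] := inD _ pe; have [q' Dq' qq] := inD _ qe.
  by move: pq; rewrite -pp -qq !gf // => ->.
rewrite pa gf // => nb; apply: (circle_not_interior ub).
apply: filterS nb => _ [p /= pe <-].
by have [p' Dp' <-] := inD _ pe; rewrite gf.
Qed.

(** Otherwise a chart square followed by the inverse of the arc would embed the square in a line,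
    which contains no open set of the plane. *)
Lemma arc_not_nbhs (A : set S) a b x : is_arc R A a b -> A x -> ~ nbhs x A.
Proof.
move=> [f [cf fi fA _ _]] Ax /surface_chart [phi [c [e [[e0 pc cphi phii phiN] _]]]].
have [g gf] := set_inj_inverse (0 : R) fi.
have cg := within_continuous_inverse hausS (@segment_compact R 0 1) cf gf.
have inA p : `|p - c| <= e -> (f @` `[0, 1]) (phi p).
  by move=> pe; rewrite fA; apply: phiN; exists p.
have cgp := @within_continuous_comp_sub _ _ _ _ _ phi g cphi inA cg.
pose h p : R * R := (g (phi p), 0).
have nh : nbhs (h c) (h @` [set p | `|p - c| <= e]).
  apply: (invariance_of_domain (f := h) e0).
    by apply: continuous_pair; [exact: cgp | exact: cst_continuous].
  move=> p q; rewrite !inE => /= pe qe [pq]; apply: phii; rewrite ?inE //.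
  have [p' Dp' pp] := inA _ pe; have [q' Dq' qq] := inA _ qe.
  by move: pq; rewrite -pp -qq !gf // => ->.
have [d d0 hd] := nbhs_box nh.
have : [set q | `|q - h c| <= d] (h c + (0, d)).
  by rewrite /= addrAC subrr add0r norm_leE /= normr0 gtr0_norm // lexx ltW.
move=> /hd [p _ [_]]; rewrite add0r => d00.
by move: d0; rewrite -d00 ltxx.
Qed.

Lemma surface_punctured_nbhs x N : nbhs x N ->
  exists O : set S, [/\ nbhs x O, O `<=` N & connected (O `\` [set x])].
Proof.
move=> /surface_chart [phi [a [e [[e0 pa cphi phii phiN] nx]]]].
exists (phi @` [set p | `|p - a| < e]); split => //.
  by move=> _ [p /= pe <-]; apply: phiN; exists p => //=; exact: ltW.
have -> : (phi @` [set p | `|p - a| < e]) `\` [set x] =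
    phi @` [set p | `|p - a| < e /\ p <> a].
  apply/seteqP; split=> [_ [[p /= pe <-] px]|_ [p /= [pe pa'] <-]].
    by exists p => //; split => // pa'; apply: px; rewrite /= pa' pa.
  split; first by exists p.
  rewrite /= -pa => h; apply: pa'; apply: phii; rewrite ?inE //=; first exact: ltW.
  by rewrite subrr normr0 ltW.
apply: connected_continuous_connected; first exact: punctured_box_connected.
by apply: continuous_subspaceW cphi => p /= [/ltW].
Qed.

End Surface.

(** * Faces of a triangulation *)

Section Faces.
Variables (R : realType) (S : topologicalType) (V : finType).
Variable G : embedded_graph R S V.
Hypothesis triG : is_triangulation G.
Implicit Types (x y z a b c w : V) (F : set S) (q : S).

Let surfS : is_surface R S. Proof. by case: triG => -[]. Qed.
Let hausS : hausdorff_space S. Proof. by case: surfS. Qed.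

Lemma bounds_face_rot F x y z : bounds_face G F x y z -> bounds_face G F y z x.
Proof.
move=> [[h1 h2 h3] [f [f1 f2 f3 f4]]]; split=> //; exists f; split => //.
by rewrite f4 /cycle3_set -setUA setUC.
Qed.

Lemma bounds_face_swap F x y z : bounds_face G F x y z -> bounds_face G F y x z.
Proof.
move=> [[h1 h2 h3] [f [f1 f2 f3 f4]]]; split.
  by split; rewrite adj_sym.
exists f; split=> //; rewrite f4 /cycle3_set.
by rewrite curveC -setUA [X in _ `|` X]setUC setUA (curveC G y z) (curveC G z x).
Qed.

(** The image of the closed disk is compact, hence closed, and each point p of the circle is the
    limit of the points (1 - t) p of the open disk. *)
Lemma bounds_face_disk F x y z : bounds_face G F x y z ->
  exists f : R * R -> S,
    [/\ {within @closed_disk R, continuous f}, set_inj (@closed_disk R) f,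
        f @` @open_disk R = F, f @` @unit_circle R = cycle3_set G x y z
      & f @` @closed_disk R = closure F].
Proof.
move=> [_ [f [f1 f2 f3 f4]]]; exists f; split => //.
have cl : closed (f @` @closed_disk R).
  by apply: compact_closed => //; apply: continuous_compact => //;
    exact: closed_disk_compact.
apply/seteqP; split; last first.
  rewrite [X in _ `<=` X]((closure_id _).1 cl); apply: closureS; rewrite -f3.
  by apply: image_subset => p; rewrite closed_diskE; left.
move=> _ [p + <-]; rewrite closed_diskE => -[op|cp].
  by apply: subset_closure; rewrite -f3; exists p.
move=> N Nfp.
have cs : continuous (fun s : R => (1 - s) *: p).
  move=> s; apply: cvgZ; last exact: cvg_cst.
  by apply: cvgB; [exact: cvg_cst | exact: cvg_id].
have Dp : @closed_disk R p by rewrite closed_diskE; right.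
have := (subspace_continuousP _ _).1 f1 p Dp N Nfp.
rewrite /nbhs /= /within /= => nfp.
have := cs 0; rewrite /continuous_at subr0 scale1r => /(_ _ nfp).
move=> /nbhs_ballP [e /= e0 he].
pose t := Num.min (e / 2) 1.
have t0 : 0 < t by rewrite lt_min ltr01 divr_gt0.
have t1 : t <= 1 by rewrite ge_min lexx orbT.
have te : t <= e / 2 by rewrite ge_min lexx.
have Dt : @open_disk R ((1 - t) *: p) by apply: scale_disk => //; rewrite t0.
exists (f ((1 - t) *: p)); split; first by rewrite -f3; exists ((1 - t) *: p).
apply: (he t); last by rewrite closed_diskE; left.
by rewrite -ball_normE /= sub0r normrN gtr0_norm //; lra.
Qed.

Lemma face_closureE F x y z : bounds_face G F x y z ->
  closure F = F `|` cycle3_set G x y z.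
Proof.
move=> /bounds_face_disk [f [_ _ <- <- <-]].
by rewrite closed_diskE image_setU.
Qed.

Lemma vpt_curve a b : adj G a b -> curve G a b (vpt G a) /\ curve G a b (vpt G b).
Proof.
move=> /curve_arc [g [_ _ <- <- <-]]; split; [exists 0 | exists 1] => //=;
  by rewrite in_itv /= ?lexx ler01.
Qed.

Lemma adj_neq a b : adj G a b -> a <> b.
Proof. by move=> + ab; rewrite ab adj_irr. Qed.

Lemma face_triangle F : is_face G F -> exists a b c, bounds_face G F a b c.
Proof. by case: triG => _ h _; exact: h. Qed.

Lemma face_disj_graph F q : is_face G F -> F q -> ~ graph_set G q.
Proof. by move=> [p _ ->] /connected_component_sub. Qed.

Lemma curve_graph a b q : adj G a b -> curve G a b q -> graph_set G q.
Proof. by move=> ab abq; right; exists a, b. Qed.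

Lemma face_eq F1 F2 q : is_face G F1 -> is_face G F2 -> F1 q -> F2 q -> F1 = F2.
Proof.
move=> [p1 _ ->] [p2 _ ->] h1 h2.
by rewrite (same_connected_component h1) (same_connected_component h2).
Qed.

Lemma face_closure_disj F1 F2 q : is_face G F1 -> is_face G F2 -> F1 q ->
  closure F2 q -> F1 = F2.
Proof.
move=> f1 f2 F1q; have [a [b [c bf]]] := face_triangle f2.
rewrite (face_closureE bf) => -[F2q|cq]; first exact: face_eq F1q F2q.
case: (face_disj_graph f1 F1q); have [[h1 h2 h3] _] := bf.
by case: cq => [[]|]; apply: curve_graph.
Qed.

Lemma face_vertex F a b c w : is_face G F -> bounds_face G F a b c ->
  closure F (vpt G w) <-> w \in [:: a; b; c].
Proof.
move=> fF bf; rewrite (face_closureE bf); have [[h1 h2 h3] _] := bf.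
split.
  case=> [Fw|]; first by case: (face_disj_graph fF Fw); left; exists w.
  rewrite !inE; case=> [[]|] /curve_vpt; case=> // ->; rewrite eqxx ?orbT //.
rewrite !inE => /or3P[] /eqP ->; right.
- by left; left; case: (vpt_curve h1).
- by left; left; case: (vpt_curve h1).
- by right; case: (vpt_curve h3).
Qed.

Lemma face_edge F a b : is_face G F -> a <> b ->
  closure F (vpt G a) -> closure F (vpt G b) -> exists c, bounds_face G F a b c.
Proof.
move=> fF ab; have [x [y [z bf]]] := face_triangle fF.
have r1 := bounds_face_rot bf; have r2 := bounds_face_rot r1.
rewrite !(face_vertex _ fF bf) !inE.
move=> /or3P[] /eqP ea /or3P[] /eqP eb; subst a b; try by case: (ab erefl).
- by exists z.
- by exists y; exact: bounds_face_swap.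
- by exists z; exact: bounds_face_swap.
- by exists x.
- by exists y.
- by exists x; exact: bounds_face_swap.
Qed.

(** Such a point of an edge lies on no other edge, so the faces with this point in their closure are
    exactly those incident with the edge. *)
Definition inner_point a b q := curve G a b q /\ ~ range (vpt G) q.

Lemma inner_point_exists a b : adj G a b -> exists q, inner_point a b q.
Proof.
move=> ab; have [g [cg gi gE g0 g1]] := curve_arc ab.
have h2 : `[0, 1]%classic (1 / 2 : R) by rewrite /= in_itv /=; lra.
exists (g (1 / 2)); split; first by rewrite -gE; exists (1 / 2).
move=> [w _ wE].
have : curve G a b (vpt G w) by rewrite wE -gE; exists (1 / 2).
have i0 : `[0, 1]%classic (0 : R) by rewrite /= in_itv /= lexx ler01.
have i1 : `[0, 1]%classic (1 : R) by rewrite /= in_itv /= lexx ler01.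
move=> /(curve_vpt ab) [wa|wb]; move: wE; [rewrite wa -g0|rewrite wb -g1].
  by move=> /gi; rewrite !inE => /(_ i0 h2); lra.
by move=> /gi; rewrite !inE => /(_ i1 h2); lra.
Qed.

Lemma inner_point_unique a b x y q : adj G a b -> adj G x y ->
  inner_point a b q -> curve G x y q -> (a = x /\ b = y) \/ (a = y /\ b = x).
Proof. by move=> ab xy [abq nq] /(curve_meet ab xy abq) []. Qed.

Lemma bounds_face_curve F a b c : bounds_face G F a b c ->
  curve G a b `<=` closure F.
Proof. by move=> bf q abq; rewrite (face_closureE bf); right; left; left. Qed.

Lemma face_inner_point F a b q : is_face G F -> adj G a b -> inner_point a b q ->
  closure F q <-> closure F (vpt G a) /\ closure F (vpt G b).
Proof.
move=> fF ab iq; split; last first.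
  move=> [Fa Fb]; have [c bf] := face_edge fF (adj_neq ab) Fa Fb.
  by apply: (bounds_face_curve bf); case: iq.
have [x [y [z bf]]] := face_triangle fF; have [[h1 h2 h3] _] := bf.
rewrite {1}(face_closureE bf) => -[Fq|].
  by case: (face_disj_graph fF Fq); apply: (curve_graph ab); case: iq.
rewrite !(face_vertex _ fF bf) !inE; case=> [[]|] /(inner_point_unique ab) h.
- by case: (h h1 iq) => -[-> ->]; rewrite !eqxx ?orbT.
- by case: (h h2 iq) => -[-> ->]; rewrite !eqxx ?orbT.
- by case: (h h3 iq) => -[-> ->]; rewrite !eqxx ?orbT.
Qed.

(* The two faces are glued along the common edge: the lower and upper halves of
   a rectangle are mapped by polar coordinates centred at the centres of the
   two face disks, both restricting to the arc [g] on the middle line. *)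
Lemma two_faces_nbhs F1 F2 a b c1 c2 q : is_face G F1 -> is_face G F2 ->
  bounds_face G F1 a b c1 -> bounds_face G F2 a b c2 -> F1 <> F2 ->
  inner_point a b q -> nbhs q (F1 `|` F2 `|` curve G a b).
Proof.
move=> fF1 fF2 bf1 bf2 F12 [abq nq].
have ab : adj G a b by case: bf1 => -[].
have [g [cg gi gE g0 g1]] := curve_arc ab.
have [t0 t0I gq] : (g @` `[0, 1]) q by rewrite gE.
have {t0I}t0I : 0 < t0 < 1.
  move: t0I; rewrite /= in_itv /= !le_eqVlt.
  move=> /andP[/orP[/eqP e0|->] /orP[/eqP e1|->]] //; exfalso; apply: nq.
  - by exists a => //; rewrite -g0 -gq e0.
  - by exists a => //; rewrite -g0 -gq e0.
  - by exists b => //; rewrite -g1 -gq e1.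
(* Here r lifts the arc g to the boundary circle of the disk that parametrises F. *)
have param F z : is_face G F -> bounds_face G F a b z ->
  exists (f : R * R -> S) (r : R -> R * R),
    [/\ {within @closed_disk R, continuous f}, set_inj (@closed_disk R) f,
        f @` @open_disk R = F, {within `[0, 1], continuous r}
      & forall t, `[0, 1]%classic t -> @unit_circle R (r t) /\ f (r t) = g t].
  move=> fF bf; have [f [cf fi fo fc fcl]] := bounds_face_disk bf.
  have [k kf] := set_inj_inverse (0 : R * R) fi.
  have ck := within_continuous_inverse hausS (@closed_disk_compact R) cf kf.
  have gC t : `[0, 1]%classic t -> exists2 p, @unit_circle R p & f p = g t.
    move=> tI; have : curve G a b (g t) by rewrite -gE; exists t.
    by move=> h; have : cycle3_set G a b z (g t) by [left; left]; rewrite -fc.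
  exists f, (k \o g); split => // [|t tI].
    apply: (@within_continuous_comp_sub _ _ _ _ _ g k cg _ ck) => t tI.
    have [p cp <-] := gC _ tI; exists p => //.
    by rewrite closed_diskE; right.
  have [p cp fp] := gC _ tI.
  by rewrite /= -fp kf // closed_diskE; right.
have [f1 [r1 [cf1 fi1 fo1 cr1 hr1]]] := param _ _ fF1 bf1.
have [f2 [r2 [cf2 fi2 fo2 cr2 hr2]]] := param _ _ fF2 bf2.
(* The first two bounds keep the parameter p.1 in [0, 1]; the bound 1 / 2 keeps the radius 1 - |p.2|
   positive, where polar coordinates are injective. *)
pose e := Num.min (Num.min t0 (1 - t0)) (1 / 2).
have e0 : 0 < e by rewrite !lt_min; lra.
have [e1 e2 e3] : [/\ e <= t0, e <= 1 - t0 & e <= 1 / 2].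
  by split; rewrite !ge_min lexx ?orbT.
pose m : R * R := (t0, 0).
pose Bx := [set p : R * R | `|p - m| <= e].
have BxP (p : R * R) : Bx p -> `[0, 1]%classic p.1 /\ - (1 / 2) <= p.2 <= 1 / 2.
  rewrite /Bx /= norm_leE /= subr0 !ler_norml in_itv /=.
  by move=> /andP[/andP[? ?] /andP[? ?]]; split; lra.
have clBx : closed Bx.
  by apply: compact_closed; [exact: norm_hausdorff | exact: box_compact].
pose Up := Bx `&` [set p | 0 <= p.2]; pose Dn := Bx `&` [set p | p.2 <= 0].
have clU : closed Up.
  apply: closedI => //.
  apply: (@closed_comp _ _ (fun p : R * R => p.2) [set r | 0 <= r]).
    by move=> p _; exact: cvg_snd.
  exact: closed_ge.
have clD : closed Dn.
  apply: closedI => //.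
  apply: (@closed_comp _ _ (fun p : R * R => p.2) [set r | r <= 0]).
    by move=> p _; exact: cvg_snd.
  exact: closed_le.
pose h1 (p : R * R) := f1 ((1 - p.2) *: r1 p.1).
pose h2 (p : R * R) := f2 ((1 + p.2) *: r2 p.1).
pose h (p : R * R) := if 0 <= p.2 then h1 p else h2 p.
have fst_I (A : set (R * R)) (r : R -> R * R) : A `<=` Bx ->
    {within `[0, 1], continuous r} -> {within A, continuous (fun p => r p.1)}.
  move=> AB cr; apply: (@within_continuous_comp_sub _ _ _ _ _ fst r _ _ cr).
    by apply: continuous_subspaceT => p; exact: cvg_fst.
  by move=> p /AB /BxP [].
have in_disk (r : R * R) s : @unit_circle R r -> 0 <= s <= 1 ->
    @closed_disk R ((1 - s) *: r).
  move=> cr; have [->|sN0] := eqVneq s 0.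
    by rewrite subr0 scale1r closed_diskE; right.
  move=> s01; rewrite closed_diskE; left; apply: scale_disk => //.
  by rewrite lt_neqAle eq_sym sN0.
have ch1 : {within Up, continuous h1}.
  apply: (@within_continuous_comp_sub _ _ _ _ _
    (fun p : R * R => (1 - p.2) *: r1 p.1) f1 _ _ cf1).
    move=> p; apply: cvgZ.
      apply: cvgB; first exact: cvg_cst.
      by apply: (continuous_subspaceT (f := snd)) => ?; exact: cvg_snd.
    by apply: (fst_I _ r1 _ cr1) => ? [].
  move=> p [Bp /= p0]; have [pI p2] := BxP _ Bp.
  by apply: in_disk; [case: (hr1 _ pI) | lra].
have ch2 : {within Dn, continuous h2}.
  apply: (@within_continuous_comp_sub _ _ _ _ _
    (fun p : R * R => (1 + p.2) *: r2 p.1) f2 _ _ cf2).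
    move=> p; apply: cvgZ.
      apply: cvgD; first exact: cvg_cst.
      by apply: (continuous_subspaceT (f := snd)) => ?; exact: cvg_snd.
    by apply: (fst_I _ r2 _ cr2) => ? [].
  move=> p [Bp /= p0]; have [pI p2] := BxP _ Bp.
  have -> : 1 + p.2 = 1 - (- p.2) by rewrite opprK.
  by apply: in_disk; [case: (hr2 _ pI) | lra].
have h_mid (p : R * R) : Bx p -> p.2 = 0 -> h p = g p.1 /\ h2 p = g p.1.
  move=> Bp p0; have [pI _] := BxP _ Bp.
  rewrite /h /h1 /h2 p0 lexx subr0 addr0 !scale1r.
  by have [_ ->] := hr1 _ pI; have [_ ->] := hr2 _ pI.
have h_up (p : R * R) : Bx p -> 0 < p.2 ->
   [/\ h p = h1 p, F1 (h p) & @open_disk R ((1 - p.2) *: r1 p.1)].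
  move=> Bp p0; have [pI p2] := BxP _ Bp; rewrite /h (ltW p0).
  have od : @open_disk R ((1 - p.2) *: r1 p.1).
    by apply: scale_disk; [case: (hr1 _ pI) | lra].
  by split=> //; rewrite -fo1; exists ((1 - p.2) *: r1 p.1).
have h_dn (p : R * R) : Bx p -> p.2 < 0 ->
   [/\ h p = h2 p, F2 (h p) & @open_disk R ((1 + p.2) *: r2 p.1)].
  move=> Bp p0; have [pI p2] := BxP _ Bp; rewrite /h leNgt p0 /=.
  have od : @open_disk R ((1 + p.2) *: r2 p.1).
    have -> : 1 + p.2 = 1 - (- p.2) by rewrite opprK.
    by apply: scale_disk; [case: (hr2 _ pI) | lra].
  by split=> //; rewrite -fo2; exists ((1 + p.2) *: r2 p.1).
have ch : {within Bx, continuous h}.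
  have -> : Bx = Up `|` Dn.
    apply/seteqP; split=> [p Bp|p [[]|[]]] //.
    by have [p0|/ltW p0] := leP 0 p.2; [left | right].
  apply: withinU_continuous => //.
    apply: subspace_eq_continuous ch1 => p; rewrite inE => -[_ /= p0].
    by rewrite /from_subspace /h p0.
  apply: subspace_eq_continuous ch2 => p; rewrite inE => -[Bp /=].
  rewrite /from_subspace le_eqVlt => /orP[/eqP p0|p0].
    by have [-> ->] := h_mid _ Bp p0.
  by have [-> _ _] := h_dn _ Bp p0.
have gcurve (p : R * R) : Bx p -> curve G a b (g p.1).
  by move=> /BxP [pI _]; rewrite -gE; exists p.1.
have F1nc (p : R * R) : Bx p -> ~ F1 (g p.1).
  by move=> Bp /(face_disj_graph fF1); apply; apply: (curve_graph ab); exact: gcurve.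
have F2nc (p : R * R) : Bx p -> ~ F2 (g p.1).
  by move=> Bp /(face_disj_graph fF2); apply; apply: (curve_graph ab); exact: gcurve.
have F1F2 (u : S) : F1 u -> ~ F2 u.
  by move=> h1u h2u; apply: F12; exact: face_eq h1u h2u.
(* Points with p.2 of the same sign are separated by polar coordinates, or by g on the middle line;
   for different signs the images lie in different ones of the disjoint sets F1, F2 and the
   graph. *)
have hi : set_inj Bx h.
  move=> p p'; rewrite !inE => Bp Bp'.
  have [pI p2] := BxP _ Bp; have [p'I p'2] := BxP _ Bp'.
  have [lt0|gt0|eq0] := ltgtP p.2 0; have [lt0'|gt0'|eq0'] := ltgtP p'.2 0.
  - have [-> _ o] := h_dn _ Bp lt0; have [-> _ o'] := h_dn _ Bp' lt0'.
    move=> /fi2; rewrite !inE !closed_diskE => /(_ (or_introl o) (or_introl o')).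
    have [c r] := hr2 _ pI; have [c' r'] := hr2 _ p'I.
    move=> /(polar_inj c c') []; [lra | lra |] => ss uu.
    have : p.1 = p'.1 by apply: gi; rewrite ?inE // -r -r' uu.
    have : p.2 = p'.2 by lra.
    by case: p p' {Bp Bp' pI p2 p'I p'2 lt0 lt0' o o' c r c' r' ss uu} =>
      [? ?] [? ?] /= -> ->.
  - have [_ k _] := h_dn _ Bp lt0; have [_ k' _] := h_up _ Bp' gt0'.
    by move=> hh; rewrite hh in k; case: (F1F2 _ k').
  - have [_ k _] := h_dn _ Bp lt0; have [k' _] := h_mid _ Bp' eq0'.
    by move=> hh; rewrite hh k' in k; case: (F2nc _ Bp').
  - have [_ k _] := h_up _ Bp gt0; have [_ k' _] := h_dn _ Bp' lt0'.
    by move=> hh; rewrite hh in k; case: (F1F2 _ k).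
  - have [-> _ o] := h_up _ Bp gt0; have [-> _ o'] := h_up _ Bp' gt0'.
    move=> /fi1; rewrite !inE !closed_diskE => /(_ (or_introl o) (or_introl o')).
    have [c r] := hr1 _ pI; have [c' r'] := hr1 _ p'I.
    move=> /(polar_inj c c') []; [lra | lra |] => ss uu.
    have : p.1 = p'.1 by apply: gi; rewrite ?inE // -r -r' uu.
    have : p.2 = p'.2 by lra.
    by case: p p' {Bp Bp' pI p2 p'I p'2 gt0 gt0' o o' c r c' r' ss uu} =>
      [? ?] [? ?] /= -> ->.
  - have [_ k _] := h_up _ Bp gt0; have [k' _] := h_mid _ Bp' eq0'.
    by move=> hh; rewrite hh k' in k; case: (F1nc _ Bp').
  - have [_ k _] := h_dn _ Bp' lt0'; have [k' _] := h_mid _ Bp eq0.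
    by move=> hh; rewrite -hh k' in k; case: (F2nc _ Bp).
  - have [_ k _] := h_up _ Bp' gt0'; have [k' _] := h_mid _ Bp eq0.
    by move=> hh; rewrite -hh k' in k; case: (F1nc _ Bp).
  - have [-> _] := h_mid _ Bp eq0; have [-> _] := h_mid _ Bp' eq0'.
    move=> /gi; rewrite !inE => /(_ pI p'I).
    have : p.2 = p'.2 by lra.
    by case: p p' {Bp Bp' pI p2 p'I p'2 eq0 eq0'} => [? ?] [? ?] /= -> ->.
have Bm : Bx m by rewrite /Bx /= subrr normr0 ltW.
have := surface_invariance_of_domain surfS e0 ch hi.
have [-> _] := h_mid _ Bm erefl; rewrite /= gq.
apply: filterS => _ [p Bp <-].
have [lt0|gt0'|eq0] := ltgtP p.2 0.
- by left; right; case: (h_dn _ Bp lt0).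
- by left; left; case: (h_up _ Bp gt0').
- by right; have [-> _] := h_mid _ Bp eq0; exact: gcurve.
Qed.

(** If F1 and F2 differ, they fill a neighbourhood of an inner point q together with the edge, so
    F3, having q in its closure, meets one of them. *)
Lemma edge_at_most_two F1 F2 F3 a b : adj G a b ->
  is_face G F1 -> is_face G F2 -> is_face G F3 ->
  (forall F, F = F1 \/ F = F2 \/ F = F3 ->
    closure F (vpt G a) /\ closure F (vpt G b)) ->
  [\/ F1 = F2, F1 = F3 | F2 = F3].
Proof.
move=> ab f1 f2 f3 hF; have [q iq] := inner_point_exists ab.
have abN := adj_neq ab.
have [a1 b1] := hF F1 (or_introl erefl).
have [a2 b2] := hF F2 (or_intror (or_introl erefl)).
have [a3 b3] := hF F3 (or_intror (or_intror erefl)).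
have [F12|F12] := pselect (F1 = F2); first by constructor 1.
have [c1 bf1] := face_edge f1 abN a1 b1; have [c2 bf2] := face_edge f2 abN a2 b2.
have /(_ _ (two_faces_nbhs f1 f2 bf1 bf2 F12 iq)) : closure F3 q.
  by apply/(face_inner_point f3 ab iq).
move=> [y [F3y [[F1y|F2y]|cy]]].
- by constructor 2; apply: face_eq F1y F3y.
- by constructor 3; apply: face_eq F2y F3y.
- by case: (face_disj_graph f3 F3y); apply: curve_graph cy.
Qed.

(** Each face has an edge of the finite graph on its boundary, and each edge has at most two
    faces. *)
Lemma face_enumeration : exists (n : nat) (F : 'I_n -> set S),
  [/\ injective F, forall i, is_face G (F i)
    & forall F', is_face G F' -> exists i, F' = F i].
Proof.
pose P (e : V * V) F := [/\ adj G e.1 e.2, is_face G F, closure F (vpt G e.1)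
   & closure F (vpt G e.2)].
(* The list [s e] is only known to contain the faces at e, hence the filter in [fs]. *)
have [e|s hs] := @choice _ _
    (fun e (s : seq (set S)) => forall F, P e F -> F \in s).
  have [[F1 P1]|] := pselect (exists F, P e F); last first.
    by move=> /forallNP h; exists [::] => F /h.
  have [[F2 [P2 F12]]|] := pselect (exists F, P e F /\ F <> F1); last first.
    move=> h; exists [:: F1] => F PF; rewrite inE; apply/eqP; apply: contrapT => FF.
    by apply: h; exists F.
  exists [:: F1; F2] => F PF; rewrite !inE.
  have [ad f1 ? ?] := P1; have [_ f2 ? ?] := P2; have [_ f ? ?] := PF.
  have [|/esym //|->|->] := edge_at_most_two ad f1 f2 f.
  - by move=> F' [->|[->|->]].
  - by rewrite eqxx.
  - by rewrite eqxx orbT.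
pose fs := undup
  [seq F <- flatten [seq s e | e <- enum {: V * V}] | `[< is_face G F >]].
exists (size fs), (fun i : 'I_(size fs) => nth set0 fs i); split.
- move=> i j /eqP; rewrite nth_uniq ?undup_uniq // => /eqP; exact: val_inj.
- move=> i; have : nth set0 fs i \in fs by apply: mem_nth.
  by rewrite mem_undup mem_filter => /andP[/asboolP].
- move=> F' fF'; have [a [b [c bf]]] := face_triangle fF'.
  have F's : F' \in fs.
    rewrite mem_undup mem_filter; apply/andP; split; first exact/asboolP.
    apply/flattenP; exists (s (a, b)); first by rewrite map_f // mem_enum.
    apply: hs; split => //=; first by case: bf => -[].
      by apply/(face_vertex _ fF' bf); rewrite !inE eqxx.
    by apply/(face_vertex _ fF' bf); rewrite !inE eqxx orbT.
  have hi : (index F' fs < size fs)%N by rewrite index_mem.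
  by exists (Ordinal hi); rewrite /= nth_index.
Qed.

End Faces.

(** The form in which finiteness is used: near q only those closed faces, edges and vertices occur
    that contain q. *)
Lemma nbhs_finite_closed (T : topologicalType) (I : finType) (A : I -> set T)
    (q : T) : (forall i, closed (A i)) ->
  nbhs q [set p | forall i, A i p -> A i q].
Proof.
move=> cA; apply: filter_forall => i.
have [Aq|Aq] := pselect (A i q); first by apply: filterE.
have : nbhs q (~` A i) by apply: open_nbhs_nbhs; split => //; exact: closed_openC.
by apply: filterS => p nA.
Qed.

Lemma connectedU_closure (T : topologicalType) (A : set T) (q : T) :
  connected A -> closure A q -> connected (A `|` [set q]).
Proof.
move=> cA Aq; apply/connectedP => E [E0 EU sE].
have AE : A `<=` E false `|` E true by rewrite -EU; left.
have no b : A `<=` E b -> closure (E b) `&` E (~~ b) = set0 -> False.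
  move=> Ab cl; have [u Eu] := E0 (~~ b).
  have : (A `|` [set q]) u by rewrite EU; case: b Eu {Ab cl}; [left | right].
  suff : ~ closure (E b) u.
    move=> nE [/Ab Ebu|/= uq]; apply: nE; first exact: subset_closure.
    by rewrite uq; exact: (closureS Ab).
  by move=> cu; have : (closure (E b) `&` E (~~ b)) u by []; rewrite cl.
have [cl0 cl1] := sE; have [A0|A1] := connected_subset sE AE cA.
  exact: no A0 cl0.
by apply: no A1 _; rewrite setIC.
Qed.

(** * Incidences between faces, edges and vertices *)

Section FaceIncidence.
Variables (R : realType) (S : topologicalType) (V : finType).
Variable G : embedded_graph R S V.
Hypothesis triG : is_triangulation G.
Hypothesis no_isolated : forall x, exists y, adj G x y.
Variables (n : nat) (F : 'I_n -> set S).
Hypotheses (Finj : injective F) (Fface : forall i, is_face G (F i)).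
Hypothesis Fall : forall F', is_face G F' -> exists i, F' = F i.
Implicit Types (i j : 'I_n) (a b c u w x y z : V) (q : S).

Let surfS : is_surface R S. Proof. by case: triG => -[]. Qed.
Let hausS : hausdorff_space S. Proof. by case: surfS. Qed.

(** Locked so that rewriting with [inE] leaves membership in [corners i] folded. *)
Definition corners i : {set V} :=
  locked [set w | `[< closure (F i) (vpt G w) >]]%SET.

Lemma cornersP i w : reflect (closure (F i) (vpt G w)) (w \in corners i).
Proof. by rewrite /corners -lock inE; exact: asboolP. Qed.

Lemma corners_bounds i a b : a \in corners i -> b \in corners i -> a != b ->
  exists2 c, bounds_face G (F i) a b c & corners i = [set a; b; c]%SET.
Proof.
move=> /cornersP ia /cornersP ib /eqP ab.
have [c bf] := face_edge triG (Fface i) ab ia ib; exists c => //.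
apply/setP => w; rewrite !inE -orbA; apply/cornersP/idP.
  by move/(face_vertex triG w (Fface i) bf); rewrite !inE.
by move=> h; apply/(face_vertex triG w (Fface i) bf); rewrite !inE.
Qed.

Lemma corners_triangle i : exists a b c, bounds_face G (F i) a b c /\
  corners i = [set a; b; c]%SET.
Proof.
have [a [b [c bf]]] := face_triangle triG (Fface i); exists a, b, c; split => //.
apply/setP => w; rewrite !inE -orbA; apply/cornersP/idP.
  by move/(face_vertex triG w (Fface i) bf); rewrite !inE.
by move=> h; apply/(face_vertex triG w (Fface i) bf); rewrite !inE.
Qed.

Lemma cycle3_uniq a b c : cycle3 G a b c -> uniq [:: a; b; c].
Proof.
move=> [/adj_neq ab /adj_neq bc /adj_neq ca].
by rewrite /= !inE negb_or; apply/and3P; split => //; [apply/andP; split|];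
  apply/eqP => // e; case: ca.
Qed.

Lemma card_corners i : #|corners i| = 3%N.
Proof.
have [a [b [c [[/cycle3_uniq + _] ->]]]] := corners_triangle i.
rewrite /= !inE negb_or => /and3P[/andP[ab ac] bc _].
by rewrite finset.setUC cardsU1 !inE negb_or eq_sym ac eq_sym bc cards2 ab.
Qed.

Lemma corners_adj i a b : a \in corners i -> b \in corners i -> a != b -> adj G a b.
Proof. by move=> ia ib ab; have [c [[]]] := corners_bounds ia ib ab. Qed.

Lemma face_curve i a b : a \in corners i -> b \in corners i -> a != b ->
  curve G a b `<=` closure (F i).
Proof.
move=> ia ib ab; have [c bf _] := corners_bounds ia ib ab.
exact: bounds_face_curve bf.
Qed.

Lemma corners_inner_point i a b q : adj G a b -> inner_point G a b q ->
  closure (F i) q <-> (a \in corners i) && (b \in corners i).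
Proof.
move=> ab iq; rewrite (face_inner_point triG (Fface i) ab iq).
by split=> [[/cornersP -> /cornersP ->]|/andP[/cornersP ? /cornersP]].
Qed.

Lemma curve_closed a b : adj G a b -> closed (curve G a b).
Proof.
move=> /curve_arc [g [cg _ <- _ _]]; apply: compact_closed => //.
by apply: continuous_compact => //; exact: segment_compact.
Qed.

Lemma near_faces q : nbhs q [set p | forall i, closure (F i) p -> closure (F i) q].
Proof.
apply: (@nbhs_finite_closed _ _ (fun i => closure (F i))) => i.
exact: closed_closure.
Qed.

Lemma near_edges q : nbhs q [set p | forall a b, adj G a b ->
  curve G a b p -> curve G a b q].
Proof.
have h : forall e : V * V, closed [set p | adj G e.1 e.2 /\ curve G e.1 e.2 p].
  move=> [a b] /=.
  have [ab|/negP ab] := boolP (adj G a b).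
    have -> : [set p | true /\ curve G a b p] = curve G a b.
      by apply/seteqP; split=> [p []|p].
    exact: curve_closed.
  have -> : [set p | false /\ curve G a b p] = set0.
    by rewrite -subset0 => p [].
  exact: closed0.
apply: filterS (nbhs_finite_closed q h) => p {}h a b ab abp.
by have [] := h (a, b) (conj ab abp).
Qed.

Lemma vertex_on_edge w : exists y, adj G w y /\ curve G w y (vpt G w).
Proof. by have [y wy] := no_isolated w; exists y; split; [|case: (vpt_curve wy)]. Qed.

Lemma face_or_edge q : (exists i, F i q) \/ (exists a b, adj G a b /\ curve G a b q).
Proof.
have [|gq] := pselect (graph_set G q).
  by move=> [[w _ <-]|]; [have [y wy] := vertex_on_edge w; right; exists w, y | right].
have [|i Fi] := Fall (F' := connected_component (~` graph_set G) q).
  by exists q.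
by left; exists i; rewrite -Fi; exact: connected_component_refl.
Qed.

(** Near an inner point q there are only the edge and the closed faces at it. With no face the arc
    would be a neighbourhood of q; with one face a closed disk would be a neighbourhood of a
    boundary point. *)
Lemma edge_two_faces a b : adj G a b ->
  #|[set i | (a \in corners i) && (b \in corners i)]%SET| = 2%N.
Proof.
move=> ab; set E := [set i | _]%SET; have [q iq] := inner_point_exists ab.
have EP i : i \in E <-> closure (F i) q.
  by rewrite inE; split => /(corners_inner_point i ab iq).
have Nq : nbhs q [set p | curve G a b p \/ exists2 i, i \in E & closure (F i) p].
  apply: filterS2 (near_faces q) (near_edges q) => p hf he.
  have [[i Fip]|[x [y [xy xyp]]]] := face_or_edge p.
    have cp : closure (F i) p by exact: subset_closure.
    by right; exists i => //; apply/EP; exact: hf.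
  left; have xyq := he _ _ xy xyp.
  by case: (inner_point_unique ab xy iq xyq) => -[-> ->] //; rewrite curveC.
apply/eqP; rewrite eqn_leq leqNgt; apply/andP; split.
  apply/negP => /card_gt2P [i1 [i2 [i3 [[e1 e2 e3] [n12 n23 n31]]]]].
  have [||||/Finj e|/Finj e|/Finj e] := @edge_at_most_two _ _ _ _ triG
    (F i1) (F i2) (F i3) _ _ ab => //.
  - move: e1 e2 e3; rewrite !inE => /andP[? ?] /andP[? ?] /andP[? ?].
    by move=> F' [->|[->|->]]; split; apply/cornersP.
  - by rewrite e eqxx in n12.
  - by rewrite e eqxx in n31.
  - by rewrite e eqxx in n23.
rewrite ltnNge; apply/negP => E1.
have [E0|/set0Pn [i0 i0E]] := boolP (E == finset.set0).
  apply: (arc_not_nbhs surfS (curve_arc ab) iq.1).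
  by apply: filterS Nq => p [//|[i]]; rewrite (eqP E0) inE.
have EE i : i \in E -> i = i0.
  move=> iE; apply/eqP; apply: contraLR E1 => ii0.
  by rewrite -ltnNge; apply/card_gt1P; exists i, i0.
have Nc : nbhs q (closure (F i0)).
  move: (i0E); rewrite inE => /andP[ia ib].
  apply: filterS Nq => p [|[i /EE -> //]].
  by apply: face_curve => //; apply/eqP; exact: (adj_neq ab).
move: (i0E); rewrite inE => /andP[ia ib].
have abN : a != b by apply/eqP; exact: (adj_neq ab).
have [c bf _] := corners_bounds ia ib abN.
have [f [cf fi fo fc fcl]] := bounds_face_disk triG bf.
have : cycle3_set G a b c q by left; left; case: iq.
rewrite -fc => -[p cp pq].
by apply: (disk_boundary_not_nbhs surfS cf fi cp); rewrite fcl pq.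
Qed.

Lemma edge_face a b : adj G a b ->
  exists2 i, a \in corners i & b \in corners i.
Proof.
move=> /edge_two_faces h.
have : (0 < #|[set i | (a \in corners i) && (b \in corners i)]%SET|)%N by rewrite h.
by move=> /card_gt0P [i]; rewrite inE => /andP[? ?]; exists i.
Qed.

Lemma closed_faces_cover q : exists i, closure (F i) q.
Proof.
have [[i Fi]|[a [b [ab abq]]]] := face_or_edge q.
  by exists i; exact: subset_closure.
have [i ia ib] := edge_face ab; exists i; apply: face_curve abq => //.
by apply/eqP; exact: (adj_neq ab).
Qed.

(** Near x, the closed faces in X and the other closed faces at x form two closed sets A and B
    covering a neighbourhood. A common point other than x would lie on an edge at x shared by a face
    of each kind, against the closure property; so A and B would disconnect a punctured
    neighbourhood of x. *)
Lemma vertex_faces_connected x (X : {set 'I_n}) :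
  (forall i, i \in X -> x \in corners i) -> (exists i, i \in X) ->
  (forall i j w, i \in X -> w != x -> w \in corners i ->
     x \in corners j -> w \in corners j -> j \in X) ->
  forall i, x \in corners i -> i \in X.
Proof.
move=> Xx [i0 i0X] Xcl i1 xi1; apply: contrapT => /negP i1X.
pose q := vpt G x.
have Nv : nbhs q [set p | forall w, p = vpt G w -> q = vpt G w].
  apply: (@nbhs_finite_closed _ _ (fun w => [set vpt G w])) => w.
  by apply: compact_closed => //; exact: compact_set1.
have [W [Oq ON cO]] := surface_punctured_nbhs surfS
  (filterI (near_faces q) (filterI (near_edges q) Nv)).
pose A := \bigcup_(i in [set i | i \in X]) closure (F i).
pose B := \bigcup_(i in [set i | (x \in corners i) && (i \notin X)]) closure (F i).
have clA : closed A.
  by apply: closed_bigcup => [|i _]; [exact: finite_finset | exact: closed_closure].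
have clB : closed B.
  by apply: closed_bigcup => [|i _]; [exact: finite_finset | exact: closed_closure].
have cover p : W p -> A p \/ B p.
  move=> /ON [hf _]; have [i ip] := closed_faces_cover p.
  have xi : x \in corners i by apply/cornersP; exact: hf.
  have [iX|iX] := boolP (i \in X); first by left; exists i.
  by right; exists i => //=; rewrite xi.
have disj p : W p -> p <> q -> A p -> B p -> False.
  move=> /ON [_ [he hv]] pq [i /= iX ip] [j /= /andP[xj jX] jp].
  have ij : F i <> F j by move=> /Finj e; move: jX; rewrite -e iX.
  (* Near x every edge passes through x, so a boundary point of a closed face lies on an edge from x
     to another corner of that face. *)
  have edge k : closure (F k) p -> ~ F k p ->
      exists y, [/\ y != x, y \in corners k, adj G x y & curve G x y p].
    have [a [b [c [bf kE]]]] := corners_triangle k.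
    rewrite {1}(face_closureE triG bf) => -[//|cp _].
    have [[ab bc ca] _] := bf.
    have key u w : u \in corners k -> w \in corners k -> adj G u w -> curve G u w p ->
        exists y, [/\ y != x, y \in corners k, adj G x y & curve G x y p].
      move=> uk wk uw uwp; have := curve_vpt uw (he _ _ uw uwp).
      have uwN : u != w by apply/eqP; exact: (adj_neq uw).
      case=> ->; [exists w | exists u]; split=> //; first by rewrite eq_sym.
        by rewrite adj_sym.
      by rewrite curveC.
    case: cp => [[]|]; apply: key => //; by rewrite kE !inE eqxx ?orbT.
  have nFi : ~ F i p.
    by move=> Fip; apply: ij; exact: (face_closure_disj triG (Fface i) (Fface j) Fip).
  have nFj : ~ F j p.
    move=> Fjp; apply: ij; apply/esym.
    exact: (face_closure_disj triG (Fface j) (Fface i) Fjp).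
  have [y [yx yi xy xyp]] := edge _ ip nFi.
  have [z [zx zj xz xzp]] := edge _ jp nFj.
  have iq : inner_point G x y p.
    by split => // -[w _ wp]; apply: pq; rewrite (hv w) // wp.
  case: (inner_point_unique xy xz iq xzp) => -[e1 e2]; last by rewrite -e1 eqxx in zx.
  by move: jX; rewrite (Xcl i j y) // e2.
have meets (k : 'I_n) : x \in corners k -> exists2 p, (W `\` [set q]) p & F k p.
  move=> /cornersP /(_ _ Oq) [p [Fp Op]]; exists p => //; split => //= pq.
  by apply: (face_disj_graph (Fface k) Fp); rewrite pq; left; exists x.
have [p0 Op0 Fp0] := meets _ (Xx _ i0X).
have [p1 Op1 Fp1] := meets _ xi1.
(* The trace of A is nonempty, open and closed in the punctured neighbourhood, so it contains p1,
   which lies in B. *)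
have /seteqP [_ /(_ _ Op1) [_ Ap1]] : (W `\` [set q]) `&` A = W `\` [set q].
  apply: cO.
  - by exists p0; split => //; exists i0 => //; exact: subset_closure.
  - exists (~` B); first exact: closed_openC.
    apply/seteqP; split=> p [[Wp pq]].
      by move=> Ap; split => // Bp; exact: (disj p).
    by move=> nB; split => //; case: (cover p Wp).
  - by exists A.
apply: (disj p1) => //; [by case: Op1 | by case: Op1 |].
by exists i1; [rewrite /= xi1 | exact: subset_closure].
Qed.

(* Counting incidences between the faces of [X] and the edges at [x]: every
   edge other than [xa] contributes 0 or 2, so [xa] contributes an even number. *)
Lemma vertex_faces_connected_minus x a (X : {set 'I_n}) : adj G x a ->
  (forall i, i \in X -> x \in corners i) -> (exists i, i \in X) ->
  (forall i j w, i \in X -> w != x -> w != a -> w \in corners i ->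
     x \in corners j -> w \in corners j -> j \in X) ->
  forall i, x \in corners i -> i \in X.
Proof.
move=> xa Xx X0 Xcl; apply: vertex_faces_connected => // i j w iX wx wi xj wj.
have [wa|wa] := eqVneq w a; last exact: (Xcl i j w).
subst w; pose at_ w := (X :&: [set k | w \in corners k])%SET.
(* Double counting: each face of X has two corners besides x. *)
have count : (\sum_(w | w != x) #|at_ w| = #|X|.*2)%N.
  transitivity (\sum_(w | w != x) \sum_(k in X) (w \in corners k))%N.
    apply: eq_bigr => w _; rewrite -sum1_card.
    rewrite big_mkcond /= [RHS]big_mkcond /=; apply: eq_bigr => k _.
    by rewrite !inE; case: (k \in X); case: (w \in _).
  rewrite exchange_big /= -muln2 -sum_nat_const; apply: eq_bigr => k kX.
  have := card_corners k; rewrite (cardsD1 x) (Xx _ kX) => -[<-].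
  rewrite -sum1_card big_mkcond [RHS]big_mkcond /=; apply: eq_bigr => w _.
  by rewrite !inE; case: (w == x) => //=; case: (w \in _).
have even_at w : w != x -> w != a -> ~~ odd #|at_ w|.
  move=> wx' wa; have [-> | /set0Pn [k]] := eqVneq (at_ w) finset.set0.
    by rewrite cards0.
  rewrite !inE => /andP[kX wk]; have xw : adj G x w.
    by apply: (corners_adj (Xx _ kX) wk); rewrite eq_sym.
  suff -> : at_ w = [set i | (x \in corners i) && (w \in corners i)]%SET.
    by rewrite edge_two_faces.
  apply/setP => m; rewrite !inE; apply/andP/andP => -[h1 h2]; split => //.
    exact: Xx.
  exact: (Xcl k m w).
have : ~~ odd #|at_ a|.
  have := congr1 odd count; rewrite odd_double (bigD1 a) //= oddD.
  rewrite (big_morph _ oddD (erefl (odd 0))) big1 ?addbF => [-> //|w /andP[? ?]].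
  by apply/negbTE; exact: even_at.
have sub : at_ a \subset [set i | (x \in corners i) && (a \in corners i)]%SET.
  by apply/fintype.subsetP => k; rewrite !inE => /andP[/Xx -> ->].
have ne : (0 < #|at_ a|)%N.
  by apply/card_gt0P; exists i; rewrite !inE iX.
(* The number at a is even, positive and at most 2, so both faces at xa belong to X, among them
   j. *)
have le2 := subset_leq_card sub; rewrite edge_two_faces // in le2.
move=> ev; have c2 : #|at_ a| = 2%N by case: #|at_ a| ne le2 ev => [|[|[|m]]].
have /eqP e : at_ a == [set i | (x \in corners i) && (a \in corners i)]%SET.
  by rewrite eqEcard sub c2 edge_two_faces.
by have : j \in at_ a by [rewrite e inE xj]; rewrite !inE => /andP[].
Qed.

(** * The link of a vertex *)

Section Link.
Variables (v : V) (L : seq V).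
Hypothesis linkL : is_link G v L.

Let cycL : is_cycle G L. Proof. by case: linkL. Qed.
Let uniqL : uniq L. Proof. by case: cycL. Qed.
Let sizeL : (2 < size L)%N. Proof. by case: cycL. Qed.

Lemma star_closed : closure (star G v) = star G v.
Proof.
apply/esym/closure_id.
have -> : star G v = \bigcup_(i in [set i | v \in corners i]) closure (F i).
  apply/seteqP; split=> p.
    by move=> [F' [/Fall [i ->] vi ip]]; exists i => //=; apply/cornersP.
  by move=> [i /= /cornersP vi ip]; exists (F i).
by apply: closed_bigcup => [|i _]; [exact: finite_finset | exact: closed_closure].
Qed.

Lemma next_prev_neq x : x \in L ->
  [/\ next L x != x, prev L x != x & next L x != prev L x].
Proof.
move=> xL; have [m s rotE] := rot_to xL.
have nextE := next_rot m uniqL; rewrite rotE in nextE.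
have us : uniq (x :: s) by rewrite -rotE rot_uniq.
have : (2 < size (x :: s))%N by rewrite -rotE size_rot.
case: s us nextE {rotE} => [//|a [//|b s]] us nextE _.
have n1 : next L x = a by rewrite -nextE /= eqxx.
move: us; rewrite /= !inE !negb_or => /and3P[/and3P[xa xb _] /andP[ab _] _].
have n2 : next L a = b by rewrite -nextE /= eq_sym (negbTE xa) eqxx.
have nx : next L x != x by rewrite n1 eq_sym.
have pn : next L x != prev L x.
  apply/eqP => e; have := next_prev uniqL x; rewrite -e n1 n2 => bx.
  by rewrite bx eqxx in xb.
split=> //; apply/eqP => e; have := next_prev uniqL x; rewrite e => /eqP.
by rewrite (negbTE nx).
Qed.

(** An inner point q of the link edge is in the closed star, so some face at v has this edge. If v
    were an end of the edge, all closed faces near q would be at v, and q would be interior to the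
    star. *)
Lemma link_face x : x \in L -> exists i, corners i = [set v; x; next L x]%SET.
Proof.
move=> xL; have xy : adj G x (next L x) by case: cycL => _ _ /next_cycle; apply.
have [q iq] := inner_point_exists xy.
have [star_q star_nq] : frontier (star G v) q.
  by case: linkL => _ <-; exists x => //; case: iq.
have {star_q}[F' [/Fall [i ->] /cornersP vi iqc]] : star G v q.
  by rewrite -star_closed.
have /andP[xi yi] := (corners_inner_point i xy iq).1 iqc.
have vN : v != x /\ v != next L x.
  apply/andP; rewrite -negb_or; apply/negP => vxy; apply: star_nq.
  apply: filterS (near_faces q) => p hp.
  have [j jp] := closed_faces_cover p; exists (F j); split => //.
  have /andP[xj yj] := (corners_inner_point j xy iq).1 (hp _ jp).
  by apply/cornersP; case/orP: vxy => /eqP ->.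
exists i; apply/eqP; rewrite eq_sym eqEcard card_corners; apply/andP; split.
  by apply/fintype.subsetP => w; rewrite !inE -orbA => /or3P[] /eqP ->.
have [nx _ _] := next_prev_neq xL.
rewrite finset.setUC cardsU1 !inE negb_or eq_sym vN.2 nx cards2.
by rewrite vN.1.
Qed.

Lemma link_notin : v \notin L.
Proof.
apply/negP => vL; have [i iE] := link_face vL.
have := card_corners i; rewrite iE finset.setUid cards2; by case: (_ != _).
Qed.

(** The faces spanned by v and an edge of L are closed under turning around v: at w in L those with
    the two edges of L at w are distinct, hence are both faces at vw. *)
Lemma link_star i : v \in corners i ->
  exists2 x, x \in L & corners i = [set v; x; next L x]%SET.
Proof.
move=> vi; pose good x j := (x \in L) && (corners j == [set v; x; next L x])%SET.
pose X := [set j | [exists x, good x j]]%SET.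
have vL (w : V) : w \in L -> w != v by move=> wL; apply: contraNneq link_notin => <-.
suff : i \in X.
  by rewrite inE => /existsP [x /andP[xL /eqP e]]; exists x.
apply: (@vertex_faces_connected v) => //.
- by move=> j; rewrite inE => /existsP [x /andP[_ /eqP ->]]; rewrite !inE eqxx.
- have [x xL] : exists x, x \in L.
    by case: (L) sizeL => [//|x s _]; exists x; exact: mem_head.
  have [j jE] := link_face xL; exists j; rewrite inE; apply/existsP; exists x.
  by rewrite /good xL jE eqxx.
- move=> j k w; rewrite inE => /existsP [x /andP[xL /eqP jE]] wv wj vk wk.
  have wL : w \in L.
    move: wj; rewrite jE !inE (negbTE wv) /= => /orP[/eqP -> //|/eqP ->].
    by rewrite mem_next.
  have pL : prev L w \in L by rewrite mem_prev.
  have [j1 j1E] := link_face wL; have [j2 j2E] := link_face pL.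
  rewrite next_prev // in j2E.
  have [nw pw np] := next_prev_neq wL.
  have j12 : j1 != j2.
    apply: contraNneq np => e; move: j1E; rewrite e j2E => /setP /(_ (prev L w)).
    rewrite !inE eqxx orbT /= (negbTE pw) (negbTE (vL _ pL)) /= => /esym /eqP ->.
    by rewrite eqxx.
  have vw : adj G v w by apply: (corners_adj vk wk); rewrite eq_sym.
  have : (k == j1) || (k == j2).
    have E2 := edge_two_faces vw.
    have sub : [set j1; j2]%SET \subset
        [set i | (v \in corners i) && (w \in corners i)]%SET.
      by apply/fintype.subsetP => m; rewrite !inE => /orP[] /eqP ->;
        rewrite ?j1E ?j2E !inE !eqxx ?orbT.
    have : k \in [set i | (v \in corners i) && (w \in corners i)]%SET.
      by rewrite inE vk.
    suff <- : [set j1; j2]%SET = [set i | (v \in corners i) && (w \in corners i)]%SET.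
      by rewrite !inE.
    by apply/eqP; rewrite eqEcard sub E2 cards2 j12.
  rewrite inE; case/orP => /eqP ->; apply/existsP.
    by exists w; rewrite /good wL j1E eqxx.
  by exists (prev L w); rewrite /good pL j2E next_prev // eqxx.
Qed.

Lemma link_neighbour u : adj G v u -> u \in L.
Proof.
move=> vu; have [i vi ui] := edge_face vu.
have [x xL iE] := link_star vi; move: ui; rewrite iE !inE -orbA => /or3P[] /eqP e.
- by case: (adj_neq vu).
- by rewrite e.
- by rewrite e mem_next.
Qed.

Lemma link_facial x u : x \in L -> u = next L x \/ u = prev L x ->
  adj G v x /\ facial G v x u.
Proof.
move=> xL hu.
have [i iE] : exists i, corners i = [set v; x; u]%SET.
  case: hu => ->; first exact: link_face.
  have pL : prev L x \in L by rewrite mem_prev.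
  have [i iE] := link_face pL.
  by exists i; rewrite iE next_prev // finset.setUAC.
have vx : v != x by apply: contraNneq link_notin => ->.
have uv : u != v.
  by apply: contraNneq link_notin => <-; case: hu => ->; rewrite ?mem_next ?mem_prev.
have ux : u != x by have [? ? _] := next_prev_neq xL; case: hu => ->.
have [vi xi ui] : [/\ v \in corners i, x \in corners i & u \in corners i].
  by rewrite iE !inE !eqxx ?orbT.
split; first exact: corners_adj vi xi vx.
have [c bf cE] := corners_bounds vi xi vx.
exists (F i) => //; move: ui; rewrite cE !inE (negbTE uv) (negbTE ux) /=.
by move=> /eqP ->.
Qed.

(** Without a chord at x, the third vertex of a 3-cycle through vx, being a neighbour of v and so on
    L, is next to x on L. Both such 3-cycles are facial, so vx would be contractible. *)
Lemma link_chord x : ~ contractible G v x -> x \in L ->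
  exists u, [/\ u \in L, u != x, u != next L x, u != prev L x & adj G x u].
Proof.
move=> nc xL; apply: contrapT => nochord; apply: nc.
have [vx f1] := link_facial xL (or_introl erefl).
have [_ f2] := link_facial xL (or_intror erefl).
split=> //; exists (next L x), (prev L x); split=> //.
  by have [_ _ /eqP] := next_prev_neq xL.
move=> u [_ xu uv]; apply: contrapT => /not_orP [/eqP n1 /eqP n2].
apply: nochord; exists u; split => //.
  by apply: link_neighbour; rewrite adj_sym.
by rewrite eq_sym; apply/eqP; exact: (adj_neq xu).
Qed.

Lemma curve_connected a b : adj G a b -> connected (curve G a b).
Proof.
move=> /curve_arc [g [cg _ <- _ _]].
by apply: connected_continuous_connected; [exact: segment_connected|].
Qed.

Lemma crossing_nonseparating m x y A B a b : rot m L = x :: A ++ y :: B ->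
  a \in A -> b \in B -> adj G a b -> adj G x y -> nonseparating_cycle3 G v x y.
Proof.
move=> rotE aA bB ab xy.
have LE w : (w \in L) = (w \in x :: A ++ y :: B) by rewrite -rotE mem_rot.
have xL : x \in L by rewrite LE mem_head.
have yL : y \in L by rewrite LE inE mem_cat inE eqxx !orbT.
have [vx _] := link_facial xL (or_introl erefl).
have [vy _] := link_facial yL (or_introl erefl).
have C3 : cycle3 G v x y by split; rewrite // adj_sym.
split=> //; set C := cycle3_set G v x y.
have us : uniq (x :: A ++ y :: B) by rewrite -rotE rot_uniq.
have cyc : cycle (adj G) (x :: A ++ y :: B) by rewrite -rotE rot_cycle; case: cycL.
pose off w := [&& w != v, w != x & w != y].
have offAB w : w \in A ++ B -> off w.
  rewrite mem_cat => wAB; apply/and3P; split.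
  - apply: contraNneq link_notin => <-; rewrite LE inE mem_cat inE.
    by case/orP: wAB => ->; rewrite ?orbT.
  - apply/eqP => e; move: us; rewrite /= mem_cat inE -e !negb_or.
    by case/orP: wAB => ->; rewrite ?andbF.
  - apply/eqP => e; move: us; rewrite /= cat_uniq /= -e => /and3P[_ _ /and3P[+ + _]].
    by rewrite negb_or; case/orP: wAB => -> //=; rewrite andbF.
have offC w : off w -> ~ C (vpt G w).
  move=> /and3P[/eqP n1 /eqP n2 /eqP n3]; have [h1 h2 h3] := C3.
  by case=> [[]|] /curve_vpt; case.
have off_curve w w' : off w -> off w' -> adj G w w' -> curve G w w' `<=` ~` C.
  move=> ow ow' ww' p wp Cp.
  have key s t : adj G s t -> curve G s t p -> s \in [:: v; x; y] ->
      t \in [:: v; x; y] -> False.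
    move=> st stp sC tC; have noff u : off u -> u \notin [:: v; x; y].
      by rewrite /off !inE !negb_or.
    case: (curve_meet ww' st wp stp) => [[u _ up]|[[e _]|[e _]]].
    - move: wp stp; rewrite -up => /(curve_vpt ww') hu /(curve_vpt st) hu'.
      have : off u by case: hu => ->.
      by move/noff; case: hu' => ->; rewrite ?sC ?tC.
    - by move/noff: ow; rewrite e sC.
    - by move/noff: ow; rewrite e tC.
  have [h1 h2 h3] := C3.
  by case: Cp => [[]|] h; apply: (key _ _ _ h) => //; rewrite !inE eqxx ?orbT.
(* M will turn out to be the whole complement. It contains the vertices of A along L, and those of B
   by the edge ab. *)
pose M := connected_component (~` C) (vpt G a).
have Ma : M (vpt G a).
  by apply: connected_component_refl; apply: offC; apply: offAB; rewrite mem_cat aA.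
have Mstep w w' : off w -> off w' -> adj G w w' -> M (vpt G w) -> M (vpt G w').
  move=> ow ow' ww' Mw; apply: connected_component_trans Mw _.
  have [wc w'c] := vpt_curve ww'.
  by exists (curve G w w') => //; split; [| exact: off_curve | exact: curve_connected].
have Mpath s w0 : path (adj G) w0 s -> all off (w0 :: s) ->
    (exists2 w, w \in w0 :: s & M (vpt G w)) -> forall w, w \in w0 :: s -> M (vpt G w).
  elim: s w0 => [|w1 s IH] w0 /=.
    by move=> _ _ [w]; rewrite inE => /eqP -> Mw w'; rewrite inE => /eqP ->.
  move=> /andP[ww p1] /and3P[off0 off1 offs] hw.
  have M1 : forall w, w \in w1 :: s -> M (vpt G w).
    apply: IH => //; first by rewrite /= off1.
    case: hw => w; rewrite inE => /orP[/eqP ->|ws] Mw; last by exists w.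
    by exists w1; [exact: mem_head | exact: Mstep Mw].
  move=> w; rewrite inE => /orP[/eqP ->|]; last exact: M1.
  by apply: (Mstep w1 w0) => //; [rewrite adj_sym | apply: M1; exact: mem_head].
have Mseq s : sorted (adj G) s -> all off s ->
    (exists2 w, w \in s & M (vpt G w)) -> forall w, w \in s -> M (vpt G w).
  by case: s => [|w0 s] //; exact: Mpath.
have [sA sB] : sorted (adj G) A /\ sorted (adj G) B.
  move: cyc; rewrite /= rcons_cat cat_path /= rcons_path => /and3P[pA _ /andP[pB _]].
  by split; [exact: path_sorted pA | exact: path_sorted pB].
have MA w : w \in A -> M (vpt G w).
  apply: Mseq => //; last by exists a.
  by apply/allP => u uA; apply: offAB; rewrite mem_cat uA.
have MB w : w \in B -> M (vpt G w).
  apply: Mseq => //.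
    by apply/allP => u uB; apply: offAB; rewrite mem_cat uB orbT.
  exists b => //; apply: (Mstep a b) => //;
    by apply: offAB; rewrite mem_cat ?aA ?bB ?orbT.
have FC i : F i `<=` ~` C.
  move=> p Fp Cp; apply: (face_disj_graph (Fface i) Fp); have [h1 h2 h3] := C3.
  by case: Cp => [[]|]; apply: curve_graph.
have Fq i q : closure (F i) q -> connected (F i `|` [set q]).
  move=> iq; apply: connectedU_closure iq.
  by have [p _ ->] := Fface i; exact: component_connected.
have FqC i q : ~ C q -> F i `|` [set q] `<=` ~` C.
  by move=> nC p [/FC //|->].
(* Adding a limit point off C keeps a face connected, so membership in M passes from face to face
   through common vertices off C. *)
have inM i q : closure (F i) q -> M q -> F i `<=` M.
  move=> iq Mq p Fp; have nC : ~ C q by exact: connected_component_sub Mq.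
  apply: connected_component_trans Mq _; exists (F i `|` [set q]); last by left.
  by split; [right | exact: FqC | exact: Fq].
have outM i q : closure (F i) q -> ~ C q -> F i `<=` M -> M q.
  move=> iq nC FM.
  have [p [Fp _]] : (F i `&` setT) !=set0 by apply: iq; exact: filterT.
  apply: connected_component_trans (FM _ Fp) _.
  exists (F i `|` [set q]); last by right.
  by split; [left | exact: FqC | exact: Fq].
have nextx : next L x \in A.
  have := next_rot m uniqL x; rewrite rotE => <-.
  by case: (A) aA => [//|a0 A1 _] /=; rewrite eqxx mem_head.
have nexty : next L y \in B.
  have := next_rot m uniqL y; rewrite rotE => <-.
  have := next_rot (size (x :: A)) us y.
  rewrite -(cat_cons x A (y :: B)) rot_size_cat => <-.
  by case: (B) bB => [//|b0 B1 _] /=; rewrite eqxx mem_head.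
(* Such a face has an edge of L; if this edge starts at x or y, its other end is in A or B. *)
have Mv i : v \in corners i -> F i `<=` M.
  move=> vi; have [u uL iE] := link_star vi.
  have [ui nui] : u \in corners i /\ next L u \in corners i.
    by rewrite iE !inE !eqxx !orbT.
  have [w wi Mw] : exists2 w, w \in corners i & M (vpt G w).
    move: uL ui nui; rewrite LE inE mem_cat inE => /or4P[/eqP ->|uA|/eqP ->|uB] ui nui.
    - by exists (next L x) => //; exact: MA.
    - by exists u => //; exact: MA.
    - by exists (next L y) => //; exact: MB.
    - by exists u => //; exact: MB.
  by apply: inM Mw; apply/cornersP.
(* Stated for s and t to serve both x and y. Across an edge sw the vertex w carries M to the next
   face, unless w = v, where [Mv] applies; only st is not crossed. *)
have Mxy s t : adj G v s -> adj G s t ->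
    off =1 (fun w => [&& w != v, w != s & w != t]) ->
    forall i, s \in corners i -> F i `<=` M.
  move=> vs st offE i si.
  pose X := [set i | (s \in corners i) && `[< F i `<=` M >]]%SET.
  suff : i \in X by rewrite inE => /andP[_ /asboolP].
  apply: (vertex_faces_connected_minus st) si.
  - by move=> j; rewrite inE => /andP[].
  - have [j vj sj] := edge_face vs; exists j; rewrite inE sj.
    by apply/asboolP; exact: Mv.
  - move=> j k w; rewrite inE => /andP[sj /asboolP FjM] ws wt wj sk wk.
    rewrite inE sk; apply/asboolP; have [wv|wv] := eqVneq w v.
      by apply: Mv; rewrite -wv.
    have ow : off w by rewrite offE wv ws wt.
    apply: (inM k (vpt G w)); first exact/cornersP.
    by apply: (outM j) => //; [apply/cornersP | exact: offC].
have Mx := Mxy x y vx xy (fun w => erefl).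
have My i : y \in corners i -> F i `<=` M.
  apply: (Mxy y x vy); first by rewrite adj_sym.
  by move=> w; rewrite /off [X in _ && X]andbC.
have Mall u : forall i, u \in corners i -> F i `<=` M.
  have [[_ conn _] _ _] := triG; have /connectP [p pp ->] := conn v u.
  elim/last_ind: p pp => [_|p w IH]; first exact: Mv.
  rewrite rcons_path last_rcons => /andP[pp uw] i wi.
  have [wv|wv] := eqVneq w v; first by apply: Mv; rewrite -wv.
  have [wx|wx] := eqVneq w x; first by apply: Mx; rewrite -wx.
  have [wy|wy] := eqVneq w y; first by apply: My; rewrite -wy.
  have ow : off w by rewrite /off wv wx wy.
  have [j uj wj] := edge_face uw.
  apply: (inM i (vpt G w)); first exact/cornersP.
  by apply: (outM j) => //; [apply/cornersP | exact: offC | exact: IH uj].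
suff -> : ~` C = M by exact: component_connected.
apply/seteqP; split; last exact: connected_component_sub.
move=> q nC; have [i iq] := closed_faces_cover q; apply: (outM i) => //.
have [c1 [c2 [c3 [_ iE]]]] := corners_triangle i.
by apply: (Mall c1); rewrite iE !inE eqxx.
Qed.

End Link.

End FaceIncidence.

(** * Crossing chords *)

Lemma rot_nth_split (V : eqType) (L : seq V) x0 i k : (i < k < size L)%N ->
  exists A B, [/\ rot i L = nth x0 L i :: A ++ nth x0 L k :: B,
    forall j, (i < j < k)%N -> nth x0 L j \in A
    & forall l, (l < size L)%N -> (l < i)%N || (k < l)%N -> nth x0 L l \in B].
Proof.
move=> /andP[ik kL]; have iL := ltn_trans ik kL.
exists (take (k - i.+1) (drop i.+1 L)), (drop k.+1 L ++ take i L); split.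
- rewrite /rot (drop_nth x0 iL) /=; congr (_ :: _).
  rewrite -{1}(cat_take_drop (k - i.+1) (drop i.+1 L)) drop_drop subnK //.
  by rewrite (drop_nth x0 kL) -catA.
- move=> j /andP[ij jk].
  have -> : nth x0 L j = nth x0 (take (k - i.+1) (drop i.+1 L)) (j - i.+1).
    by rewrite nth_take ?nth_drop ?subnKC //; lia.
  by rewrite mem_nth // size_take size_drop; case: ifP => _; lia.
- move=> l lL /orP[li|kl]; rewrite mem_cat; apply/orP.
    right; have -> : nth x0 L l = nth x0 (take i L) l by rewrite nth_take.
    by rewrite mem_nth // size_take iL.
  left; have -> : nth x0 L l = nth x0 (drop k.+1 L) (l - k.+1).
    by rewrite nth_drop subnKC.
  by rewrite mem_nth // size_drop; lia.
Qed.

Section CrossingChords.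
Variables (V : eqType) (L : seq V) (e : rel V).
Hypothesis uniqL : uniq L.
Hypothesis chordE : forall x, x \in L ->
  exists u, [/\ u \in L, u != x, u != next L x, u != prev L x & e x u].

(** Chords are expressed by positions in the list, recording only that these are not consecutive
    integers, so the wrap-around of [next] causes no cases. *)
Lemma chord_positions x0 j : (j < size L)%N -> exists l,
  [/\ (l < size L)%N, (l.+1 < j)%N || (j.+1 < l)%N & e (nth x0 L j) (nth x0 L l)].
Proof.
move=> jL; have [u [uL ux un up xu]] := chordE (mem_nth x0 jL).
have iL : (index u L < size L)%N by rewrite index_mem.
exists (index u L); split; rewrite ?nth_index //.
have nextE m : (m.+1 < size L)%N -> next L (nth x0 L m) = nth x0 L m.+1.
  move=> mL; have mL' := ltnW mL; rewrite next_nth mem_nth // index_uniq //.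
  by case: (L) mL => //= y s ms; apply: set_nth_default.
case: (ltngtP (index u L) j) => [lj|jl|lj]; last first.
- by case/eqP: ux; rewrite -lj nth_index.
- apply/orP; right; rewrite ltn_neqAle jl andbT; apply/eqP => jE.
  case/eqP: un; rewrite -{1}(nth_index x0 uL) -jE nextE //.
  by rewrite jE.
- apply/orP; left; rewrite ltn_neqAle lj andbT; apply/eqP => jE.
  case/eqP: up; rewrite -jE -nextE ?jE // nth_index //.
  by rewrite prev_next.
Qed.

(* Take a chord [ik] with [k - i] minimal and [j := i + 1]: a chord of [j]
   ending between [i] and [k] would be shorter. *)
Lemma crossing_chords x0 : (0 < size L)%N -> exists i j k l : nat,
  [/\ (i < j < k)%N, (k < size L)%N && (l < size L)%N, (l < i)%N || (k < l)%N,
      e (nth x0 L i) (nth x0 L k) & e (nth x0 L j) (nth x0 L l)].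
Proof.
move=> L0.
pose P d := (1 < d)%N && [exists i : 'I_(size L),
  (i + d < size L)%N && e (nth x0 L i) (nth x0 L (i + d))].
have PP i k : (i.+1 < k)%N -> (k < size L)%N ->
    e (nth x0 L i) (nth x0 L k) -> P (k - i)%N.
  move=> ik kL ek; have iL : (i < size L)%N by apply: ltn_trans kL; apply: ltnW.
  rewrite /P ltn_subRL addn1 ik; apply/existsP; exists (Ordinal iL) => /=.
  by rewrite subnKC ?kL // ltnW // ltnW.
have exP : exists d, P d.
  have [l [lL /orP[//|l1] el]] := chord_positions x0 L0.
  by exists (l - 0)%N; exact: PP.
case: (ex_minnP exP) => d /andP[d1 /existsP [i /andP[idL eid]]] dmin.
have jL : (i.+1 < size L)%N by apply: leq_ltn_trans idL; rewrite -addn1 leq_add2l ltnW.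
have [l [lL lj el]] := chord_positions x0 jL.
exists (i : nat), i.+1, (i + d)%N, l; split=> //.
- by rewrite ltnSn -addn1 ltn_add2l.
- by rewrite idL.
case/orP: lj => [|jl]; first by rewrite ltnS => ->.
rewrite orbC ltnNge; apply/orP; left; apply/negP => lid.
have := dmin _ (PP _ _ jl lL el); rewrite leqNgt => /negP; apply.
by lia.
Qed.

End CrossingChords.

Lemma mem_link_path (V : eqType) (L : seq V) m x y A B a b :
  uniq L -> rot m L = x :: A ++ y :: B -> a \in A -> b \in B ->
  a \in link_path L x y /\ b \in link_path L y x.
Proof.
move=> uniqL rotE aA bB.
have us : uniq (x :: A ++ y :: B) by rewrite -rotE rot_uniq.
have mL w : (w \in L) = (w \in x :: A ++ y :: B) by rewrite -rotE mem_rot.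
have xL : x \in L by rewrite mL mem_head.
have yL : y \in L by rewrite mL inE mem_cat inE eqxx !orbT.
rewrite /link_path -!(arc_rot m uniqL) // rotE left_arc // right_arc //.
by rewrite !mem_rcons !inE aA bB !orbT.
Qed.

Lemma nonseparating_cycle3C (R : realType) (S : topologicalType) (V : finType)
    (G : embedded_graph R S V) (v x y : V) :
  nonseparating_cycle3 G v x y -> nonseparating_cycle3 G v y x.
Proof.
move=> [[vx xy yv] c]; split; first by split; rewrite adj_sym.
have -> : cycle3_set G v y x = cycle3_set G v x y => //.
rewrite /cycle3_set (curveC G v y) (curveC G y x) (curveC G x v).
by rewrite setUC setUA setUAC.
Qed.

Theorem theorem5 (R : realType) (S : topologicalType) (V : finType)
    (G : embedded_graph R S V) (v : V) (L : seq V)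
    (irrG : is_irreducible_triangulation G)
    (S_not_sphere : ~ is_sphere R S)
    (linkL : is_link G v L) :
  exists vi vj vk vl : V,
    [/\ uniq [:: vi; vj; vk; vl]
          /\ {subset [:: vi; vj; vk; vl] <= L},
        nonseparating_cycle3 G v vi vk,
        nonseparating_cycle3 G v vj vl
      & (vj \in link_path L vi vk /\ vl \in link_path L vk vi)
        \/ (vj \in link_path L vk vi /\ vl \in link_path L vi vk)].
Proof.
have [triG nc] := irrG; have [[sizeL uniqL cycL] _] := linkL.
have conn : forall x y, connect (adj G) x y by case: triG => -[].
have [a [b ab]] : exists a b, adj G a b.
  by case: (L) sizeL cycL => [//|a [//|b s]] _ /andP[ab _]; exists a, b.
have no_isolated x : exists y, adj G x y.
  have [xa|xa] := eqVneq x a; first by exists b; rewrite xa.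
  have /connectP [[|y p] /=] := conn x a; first by move=> _ e; rewrite e eqxx in xa.
  by move=> /andP[xy _] _; exists y.
have [n [F [Finj Fface Fall]]] := face_enumeration triG.
have chord x := link_chord triG no_isolated Finj Fface Fall linkL (nc v x).
have L0 : (0 < size L)%N by apply: ltn_trans sizeL.
have [i [j [k [l [/andP[ij jk] /andP[kL lL] lik eik ejl]]]]] :=
  crossing_chords uniqL chord v L0.
have ik := ltn_trans ij jk; have jL := ltn_trans jk kL; have iL := ltn_trans ij jL.
have nonsep := crossing_nonseparating triG no_isolated Finj Fface Fall linkL.
pose p m := nth v L m.
have [|A [B [rotE hA hB]]] := @rot_nth_split _ L v i k; first by rewrite ik.
have jA : p j \in A by apply: hA; rewrite ij.
have lB : p l \in B by exact: hB.
exists (p i), (p j), (p k), (p l); split.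
- split; last first.
    by move=> w; rewrite !inE => /or4P[] /eqP ->; exact: mem_nth.
  rewrite -[uniq _]/(uniq [seq p m | m <- [:: i; j; k; l]]) map_inj_in_uniq.
    rewrite /= !inE !negb_or (ltn_eqF ij) (ltn_eqF ik) (ltn_eqF jk) /= andbT.
    by apply/and3P; split; lia.
  by move=> m m' hm hm' /eqP; rewrite nth_uniq // => [/eqP //||];
    [move: hm | move: hm']; rewrite !inE => /or4P[] /eqP ->.
- exact: nonsep rotE jA lB ejl eik.
(* The chords exchange roles: L is cut at j and l, which separate i from k. The cut starts at the
   smaller position, hence the swap when l < i. *)
- case/orP: lik => [li|kl].
    have lj := ltn_trans li ij.
    have [|A' [B' [rotE' hA' hB']]] := @rot_nth_split _ L v l j; first by rewrite lj.
    apply: nonseparating_cycle3C; apply: (nonsep _ _ _ _ _ (p i) (p k) rotE') => //.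
    + by apply: hA'; rewrite li.
    + by apply: hB' => //; rewrite jk orbT.
    + by rewrite adj_sym.
  have jl := ltn_trans jk kl.
  have [|A' [B' [rotE' hA' hB']]] := @rot_nth_split _ L v j l; first by rewrite jl.
  apply: (nonsep _ _ _ _ _ (p k) (p i) rotE') => //.
  + by apply: hA'; rewrite jk.
  + by apply: hB' => //; rewrite ij.
  + by rewrite adj_sym.
- by left; exact: mem_link_path rotE jA lB.
Qed.
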